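(* Let $R$ be a ring, and let $M$ be a finitely generated right $R$-module with $\mathrm{End}_R(M)=S$. For each $I\in\mathcal{T}(S)$, fix a countably generated module $X_I$ in $\mathrm{Add}(M)$ such that the trace ideal of $\mathrm{Hom}_R(M,X_I)$ is $I$; let $G_I\colon\mathrm{Add}(S/I)\to\mathrm{Add}(M)/\mathcal{J}_{X_I}$ denote the equivalence inverse to the one induced by $\mathrm{Hom}_R(M,-)\otimes_S S/I$. Then: (i) Let $\alpha_I\colon V(S/I)\to V^*(M)$ be the composition of the embedding $\iota_I\colon V(S/I)\to V^*(S)$ and the isomorphism $V^*(S)\cong V^*(M)$ induced by $-\otimes_S M$. If $I\neq 0$, then $\alpha_I([Q])=[G_I(Q)\oplus X_I^{(\omega)}]$ for every $[Q]\in V(S/I)$. (ii) Let $Y$ be an object of $\mathrm{Add}_{\aleph_0}(M)$ and let $I\in\mathcal{T}(S)$. Then $[Y]\in\alpha_I(V(S/I))$ if and only if $Y\cong Y\oplus X_I^{(\omega)}$ and $Y$ is an object of $\mathrm{add}(M\oplus X_I^{(\omega)})$. (iii) The set $B(M)=\bigcup_{I\in\mathcal{T}(S)\setminus\{0\}}\alpha_I(V(S/I))$ is a subsemigroup of $V^*(M)\setminus V(M)$. (iv) $V(M)\sqcup B(M)=\bigcup_{I\in\mathcal{T}(S)}\alpha_I(V(S/I))$ is a submonoid of $V^*(M)$.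
   Context: Rings are associative with $1$, not necessarily commutative. For a module $L$: $\mathrm{add}(L)$, $\mathrm{Add}(L)$ are the full subcategories of modules isomorphic to direct summands of finite, respectively arbitrary, direct sums of copies of $L$; $\mathrm{Add}_{\aleph_0}(M)$ consists of the countably generated modules in $\mathrm{Add}(M)$ (for $M$ finitely generated). $V(M)$ is the commutative monoid of isomorphism classes $[N]$ of modules in $\mathrm{add}(M)$, and $V^*(M)$ that of countably generated modules in $\mathrm{Add}(M)$, both with $[N]+[L]=[N\oplus L]$. $V(S)$, $V^*(S)$ are taken for the right module $S_S$, so they classify finitely, respectively countably, generated projective right $S$-modules; $\mathrm{Add}(S/I)$ is the category of projective right $S/I$-modules. $N^{(\omega)}$ is the direct sum of countably infinitely many copies of $N$. The trace of a projective right $S$-module $P$ is $\sum_{f\in\mathrm{Hom}_S(P,S)}f(P)$; $\mathcal{T}(S)$ is the set of ideals of $S$ that are traces of countably generated projective right $S$-modules. A countably generated projective right $S$-module $P$ is $I$-big if every countably generated projective right $S$-module $Q$ with $QI=Q$ is a homomorphic image of $P$. For $I\in\mathcal{T}(S)$ and a finitely generated projective right $S/I$-module $P'$, there is, up to isomorphism, a unique countably generated projective $I$-big right $S$-module $P$ with $P/PI\cong P'$; $\iota_I\colon V(S/I)\to V^*(S)$ is the (semigroup) embedding $[P']\mapsto[P]$. For $X\in\mathrm{Add}(M)$, $\mathcal{J}_X(A,B)$ is the set of $R$-homomorphisms $A\to B$ that factor through $X^{(\Lambda)}$ for some set $\Lambda$; $\mathrm{Add}(M)/\mathcal{J}_X$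 has the objects of $\mathrm{Add}(M)$ and morphisms $\mathrm{Hom}_R(A,B)/\mathcal{J}_X(A,B)$. When $I$ is the trace of $\mathrm{Hom}_R(M,X)$ and $X$ is countably generated, the functor $\mathrm{Hom}_R(M,-)\otimes_S S/I$ induces an equivalence $\mathrm{Add}(M)/\mathcal{J}_X\to\mathrm{Add}(S/I)$, restricting to an equivalence $\mathrm{Add}_{\aleph_0}(M)/\mathcal{J}_X\to\mathrm{Add}_{\aleph_0}(S/I)$ between countably generated objects. $G_I$ is the inverse equivalence for $X=X_I$, and it is taken to send countably generated projective $S/I$-modules to countably generated modules in $\mathrm{Add}(M)$. *)

(* Defs.v *)
From HB Require Import structures.
From mathcomp Require Import all_boot all_order all_algebra.
From mathcomp Require Import generic_quotient ring_quotient.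
From mathcomp Require Import boolp classical_sets functions cardinality fsbigop.

Set Implicit Arguments.
Unset Strict Implicit.
Unset Printing Implicit Defensive.

Import GRing.Theory.
Local Open Scope ring_scope.
Local Open Scope quotient_scope.

(* MathComp modules are left modules: a right [R]-module is a left module over
   the opposite ring [R^c], the right action being [v r = (r : R^c) *: v]. *)
Notation rmodType R := (lmodType R^c).

(* The right module R_R: in [(R^c)^o] one has [a *: x = x * a] (product of [R]). *)
Notation rregular R := ((R^c)^o).

Section Hom.
Variable A : pzRingType.
Implicit Types U V W : lmodType A.

Definition lhom U V : Type := {linear U -> V}.

Lemma lhomP U V (f g : lhom U V) : f =1 g -> f = g.
Proof.
case: f g => f cf [g cg] /= /funext fg; subst g.
suff -> : cf = cg by [].
case: cf cg => [[fa] [fs]] [[ga] [gs]].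
by rewrite (Prop_irrelevance fa ga) (Prop_irrelevance fs gs).
Qed.

HB.instance Definition _ U V := gen_eqMixin (lhom U V).
HB.instance Definition _ U V := gen_choiceMixin (lhom U V).

Definition lhom_id U : lhom U U := idfun.
Definition lhom_comp U V W (g : lhom V W) (f : lhom U V) : lhom U W := g \o f.

Definition lhom_zero U V : lhom U V := @GRing.null_fun U V.
Definition lhom_opp U V (f : lhom U V) : lhom U V := \- f.
Definition lhom_add U V (f g : lhom U V) : lhom U V := f \+ g.

Fact lhom_addA U V : associative (@lhom_add U V).
Proof. by move=> f g h; apply: lhomP => x /=; rewrite addrA. Qed.
Fact lhom_addC U V : commutative (@lhom_add U V).
Proof. by move=> f g; apply: lhomP => x /=; rewrite addrC. Qed.
Fact lhom_add0 U V : left_id (@lhom_zero U V) (@lhom_add U V).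
Proof. by move=> f; apply: lhomP => x /=; rewrite add0r. Qed.
Fact lhom_addN U V : left_inverse (@lhom_zero U V) (@lhom_opp U V) (@lhom_add U V).
Proof. by move=> f; apply: lhomP => x /=; rewrite addNr. Qed.
HB.instance Definition _ U V := GRing.isZmodule.Build (lhom U V)
  (@lhom_addA U V) (@lhom_addC U V) (@lhom_add0 U V) (@lhom_addN U V).

End Hom.

Section EndRing.
Variables (A : pzRingType) (M : lmodType A).

Definition Endo : Type := lhom M M.
HB.instance Definition _ := GRing.Zmodule.on Endo.

Definition Endo_mul (f g : Endo) : Endo := lhom_comp f g.
Fact Endo_mulA : associative Endo_mul. Proof. by move=> *; exact: lhomP. Qed.
Fact Endo_mul1 : left_id (lhom_id M) Endo_mul. Proof. by move=> *; exact: lhomP. Qed.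
Fact Endo_mulr1 : right_id (lhom_id M) Endo_mul. Proof. by move=> *; exact: lhomP. Qed.
Fact Endo_mulDl : left_distributive Endo_mul +%R.
Proof. by move=> *; exact: lhomP. Qed.
Fact Endo_mulDr : right_distributive Endo_mul +%R.
Proof. by move=> f g h; apply: lhomP => x /=; rewrite linearD. Qed.
HB.instance Definition _ := GRing.Zmodule_isPzRing.Build Endo
  Endo_mulA Endo_mul1 Endo_mulr1 Endo_mulDl Endo_mulDr.

(* [Hom(M, N)] is a right [Endo M]-module by composition. *)
Variable N : lmodType A.
Definition lhom_scale (s : Endo^c) (h : lhom M N) : lhom M N := lhom_comp h (s : Endo).
Fact lhom_scaleA a b h : lhom_scale a (lhom_scale b h) = lhom_scale (a * b) h.
Proof. exact: lhomP. Qed.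
Fact lhom_scale1 : left_id 1 lhom_scale. Proof. by move=> *; exact: lhomP. Qed.
Fact lhom_scaleDr : right_distributive lhom_scale +%R.
Proof. by move=> *; exact: lhomP. Qed.
Fact lhom_scaleDl h : {morph lhom_scale^~ h : a b / a + b}.
Proof. by move=> a b; apply: lhomP => x /=; rewrite linearD. Qed.
HB.instance Definition _ := GRing.Zmodule_isLmodule.Build Endo^c (lhom M N)
  lhom_scaleA lhom_scale1 lhom_scaleDr lhom_scaleDl.

End EndRing.

Section HomPost.
Variables (A : pzRingType) (M N N' : lmodType A) (f : lhom N N').
Definition lhom_post_fun (h : lhom M N) : lhom M N' := lhom_comp f h.
Fact lhom_post_linear : linear lhom_post_fun.
Proof. by move=> a g h; apply: lhomP => x /=; rewrite linearD. Qed.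
HB.instance Definition _ := GRing.isLinear.Build (Endo M)^c (lhom M N) (lhom M N')
  _ lhom_post_fun lhom_post_linear.
Definition lhom_post : lhom (lhom M N) (lhom M N') := lhom_post_fun.
End HomPost.

Section Span.
Variables (A : pzRingType) (V : lmodType A).

Definition mspan (X : set V) : {pred V} := fun v =>
  `[< forall U : {pred V}, GRing.submod_closed U ->
        (forall x, X x -> x \in U) -> v \in U >].

Fact span_closed X : GRing.submod_closed (mspan X).
Proof.
split=> [|a u v /asboolP uX /asboolP vX]; apply/asboolP => U Usub XU.
  by case: Usub.
by case: (Usub) => _; apply; [exact: uX|exact: vX].
Qed.
HB.instance Definition _ (X : set V) := GRing.isSubmodClosed.Build A V (mspan X)
  (GRing.submod_closed_semi (span_closed X)).

Definition fin_gen := exists n (u : 'I_n -> V), forall v, v \in mspan (range u).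
Definition count_gen := exists u : nat -> V, forall v, v \in mspan (range u).

End Span.

Section QuotientModule.
Variables (A : pzRingType) (V : lmodType A) (X : set V).

Definition quotmod : Type := @Quotient.quot V (mspan X).
HB.instance Definition _ := EqQuotient.on quotmod.
HB.instance Definition _ := GRing.Zmodule.on quotmod.

Definition quotmod_pi (v : V) : quotmod := \pi_(@Quotient.quot V (mspan X)) v.

Lemma quotmod_piP u v : quotmod_pi u = quotmod_pi v <-> u - v \in mspan X.
Proof.
rewrite /quotmod_pi.
by split => [/eqP|/= uv]; [|apply/eqP]; rewrite -Quotient.idealrBE.
Qed.

Lemma quotmod_repr (x : quotmod) : quotmod_pi (repr x) = x.
Proof. exact: reprK. Qed.

Lemma quotmod_piD : {morph quotmod_pi : u v / u + v}.
Proof. by move=> u v; rewrite /quotmod_pi raddfD. Qed.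

Definition quotmod_scale (a : A) (x : quotmod) : quotmod :=
  quotmod_pi (a *: repr x).

Lemma quotmod_piZ a : {morph quotmod_pi : u / a *: u >-> quotmod_scale a u}.
Proof.
move=> u; apply/quotmod_piP; rewrite -scalerBr rpredZ //.
by apply/quotmod_piP; rewrite quotmod_repr.
Qed.

Fact quotmod_scaleA a b x :
  quotmod_scale a (quotmod_scale b x) = quotmod_scale (a * b) x.
Proof. by rewrite -(quotmod_repr x) -!quotmod_piZ scalerA. Qed.
Fact quotmod_scale1 : left_id 1 quotmod_scale.
Proof. by move=> x; rewrite -(quotmod_repr x) -quotmod_piZ scale1r. Qed.
Fact quotmod_scaleDr : right_distributive quotmod_scale +%R.
Proof.
move=> a x y; rewrite -(quotmod_repr x) -(quotmod_repr y).
by rewrite -quotmod_piD -!quotmod_piZ scalerDr quotmod_piD.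
Qed.
Fact quotmod_scaleDl x : {morph quotmod_scale^~ x : a b / a + b}.
Proof.
by move=> a b; rewrite -(quotmod_repr x) -!quotmod_piZ scalerDl quotmod_piD.
Qed.
HB.instance Definition _ := GRing.Zmodule_isLmodule.Build A quotmod
  quotmod_scaleA quotmod_scale1 quotmod_scaleDr quotmod_scaleDl.

Fact quotmod_pi_linear : linear quotmod_pi.
Proof. by move=> a u v; rewrite quotmod_piD quotmod_piZ. Qed.
HB.instance Definition _ := GRing.isLinear.Build A V quotmod _ quotmod_pi
  quotmod_pi_linear.

End QuotientModule.

Section QuotientMap.
Variables (A : pzRingType) (V W : lmodType A) (X : set V) (Y : set W).
Variable f : lhom V W.
Hypothesis fXY : forall x, X x -> f x \in mspan Y.

Lemma span_map v : v \in mspan X -> f v \in mspan Y.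
Proof.
move/asboolP => /(_ (fun v => f v \in mspan Y)); apply; last by move=> x /fXY.
by split=> [|a u w uY wY]; rewrite unfold_in ?linear0 ?rpred0 // linearP rpredD ?rpredZ.
Qed.

Definition quotmod_map_fun (x : quotmod X) : quotmod Y := quotmod_pi Y (f (repr x)).

Lemma quotmod_map_pi v : quotmod_map_fun (quotmod_pi X v) = quotmod_pi Y (f v).
Proof.
apply/quotmod_piP; rewrite -linearB span_map //.
by apply/quotmod_piP; rewrite quotmod_repr.
Qed.

Fact quotmod_map_linear : linear quotmod_map_fun.
Proof.
move=> a x y; rewrite -(quotmod_repr x) -(quotmod_repr y) -linearP.
by rewrite !quotmod_map_pi linearP linearP.
Qed.
HB.instance Definition _ := GRing.isLinear.Build A (quotmod X) (quotmod Y) _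
  quotmod_map_fun quotmod_map_linear.
Definition quotmod_map : lhom (quotmod X) (quotmod Y) := quotmod_map_fun.
End QuotientMap.

(* V^(L): families of elements of V indexed by L with finite support.  (Any set
   L carries a choiceType structure, classically.) *)
Section DirectSum.
Variables (A : pzRingType) (L : choiceType) (V : lmodType A).

Definition fin_supp : {pred L -> V} := fun f => `[< finite_set [set l | f l <> 0] >].

Fact fin_supp_closed : GRing.submod_closed fin_supp.
Proof.
split=> [|a f g /asboolP fs /asboolP gs]; apply/asboolP.
  by rewrite (_ : [set _ | _] = set0)%classic //; apply/seteqP; split=> l //= /(_ erefl).
apply: sub_finite_set (_ : finite_set ([set l | f l <> 0] `|` [set l | g l <> 0])%classic).
  move=> l /= fgl; have [fl|] := pselect (f l = 0); [right|by left].
  by move=> gl; apply: fgl; rewrite fctE /= [X in X + _](_ : _ = a *: f l) // fl gl scaler0 addr0.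
by rewrite finite_setU.
Qed.

Record dsum : Type := DSum { dsum_fun :> L -> V; _ : fin_supp dsum_fun }.
HB.instance Definition _ := [isSub for dsum_fun].
HB.instance Definition _ := [Choice of dsum by <:].
HB.instance Definition _ := GRing.SubChoice_isSubLmodule.Build A (L -> V)
  fin_supp dsum (GRing.submod_closed_semi fin_supp_closed).

End DirectSum.

Section DirectSumMaps.
Variables (A : pzRingType) (V : lmodType A).

Lemma dsum_supp (L : choiceType) (f : dsum L V) : finite_set [set l | f l <> 0].
Proof. by case: f => f /= /asboolP. Qed.

Lemma dsumP (L : choiceType) (f g : dsum L V) : f =1 g -> f = g.
Proof. by move=> fg; apply/val_inj/funext. Qed.

Section Lift.
Variables (L : choiceType) (W : lmodType A) (v : L -> lhom V W).

Definition dsum_lift_fun (f : dsum L V) : W := \sum_(l \in setT) v l (f l).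

Lemma dsum_lift_sum (f : dsum L V) (D : set L) :
  ([set l | f l <> 0] `<=` D)%classic ->
  dsum_lift_fun f = \sum_(l \in D) v l (f l).
Proof.
move=> fD; apply/esym/fsbig_widen => // l [_ /= nDl].
by have [->|/fD//] := pselect (f l = 0); rewrite linear0.
Qed.

Fact dsum_lift_linear : linear dsum_lift_fun.
Proof.
move=> a f g; pose D : set L := ([set l | f l <> 0] `|` [set l | g l <> 0])%classic.
have finD : finite_set D by rewrite finite_setU; split; exact: dsum_supp.
rewrite !(@dsum_lift_sum _ D) => [|l /= gl|l /= fl|l /= fgl].
- rewrite !fsbig_finite // scaler_sumr -big_split /=.
  by apply: eq_bigr => l _; rewrite -linearP.
- by right.
- by left.
have [fl|] := pselect (f l = 0); [right|by left].
move=> gl; apply: fgl; rewrite -[LHS]/(a *: f l + g l).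
by rewrite fl gl scaler0 addr0.
Qed.
HB.instance Definition _ := GRing.isLinear.Build A (dsum L V) W _
  dsum_lift_fun dsum_lift_linear.
Definition dsum_lift : lhom (dsum L V) W := dsum_lift_fun.
End Lift.

Section Inj.
Variables (L : choiceType) (l : L).
Definition dsum_inj_raw (v : V) : L -> V := fun k => if k == l then v else 0.
Fact dsum_inj_supp v : fin_supp (dsum_inj_raw v).
Proof.
apply/asboolP/(sub_finite_set _ (finite_set1 l)) => k /=.
by rewrite /dsum_inj_raw; case: eqP.
Qed.
Definition dsum_inj_fun (v : V) : dsum L V := DSum (dsum_inj_supp v).
Fact dsum_inj_linear : linear dsum_inj_fun.
Proof.
move=> a u v; apply: dsumP => k; rewrite -[RHS]/(a *: dsum_inj_raw u k + dsum_inj_raw v k).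
by rewrite /= /dsum_inj_raw; case: eqP => // _; rewrite scaler0 addr0.
Qed.
HB.instance Definition _ := GRing.isLinear.Build A V (dsum L V) _
  dsum_inj_fun dsum_inj_linear.
Definition dsum_inj : lhom V (dsum L V) := dsum_inj_fun.
End Inj.

Lemma dsum_lift_inj (L : choiceType) (W : lmodType A) (v : L -> lhom V W) l x :
  dsum_lift v (dsum_inj l x) = v l x.
Proof.
rewrite [LHS](@dsum_lift_sum _ _ _ _ [set l]%classic); last first.
  by move=> k /=; rewrite /dsum_inj_raw; case: eqP.
by rewrite fsbig_set1 /= /dsum_inj_raw eqxx.
Qed.

Lemma dsum_decomp (L : choiceType) (f : dsum L V) :
  f = \sum_(l \in [set l | f l <> 0]) dsum_inj l (f l).
Proof.
have ev k : {morph (fun g : dsum L V => g k) : g h / g + h} by [].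
apply: dsumP => k; rewrite fsbig_finite; last exact: dsum_supp.
rewrite (big_morph (fun g : dsum L V => g k) (ev k) (erefl : (0 : dsum L V) k = 0)).
have [fk0|fk] := pselect (f k = 0).
  rewrite fk0 big1 // => l _ /=; rewrite /dsum_inj_raw.
  by case: eqP => // <-.
rewrite (bigD1_seq k) ?fset_uniq //=; last first.
  by rewrite in_fset_set ?inE //; exact: dsum_supp.
rewrite /dsum_inj_raw eqxx big1 ?addr0 // => l /eqP lk.
by case: eqP => // kl; case: lk.
Qed.

Lemma dsum_hom_ext (L : choiceType) (W : lmodType A) (f g : lhom (dsum L V) W) :
  (forall l x, f (dsum_inj l x) = g (dsum_inj l x)) -> f = g.
Proof.
move=> fg; apply: lhomP => x; rewrite (dsum_decomp x) fsbig_finite; last exact: dsum_supp.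
by rewrite !linear_sum; apply: eq_bigr.
Qed.

End DirectSumMaps.

Section AddCategories.
Variable A : pzRingType.
Implicit Types (U V : lmodType A).

Definition mod_iso U V := exists f : lhom U V, bijective f.

(* add(U), Add(U) and Add_{aleph_0}(U) *)
Definition in_add U V := exists n (W : lmodType A), mod_iso (V * W)%type (dsum 'I_n U).
Definition in_Add U V :=
  exists (L : choiceType) (W : lmodType A), mod_iso (V * W)%type (dsum L U).
Definition in_Addc U V := count_gen V /\ in_Add U V.

(* The morphisms U -> V that factor through X^(L) for some L, as a subgroup of
   [lhom U V]; Hom/J_X is the quotient group. *)
Section Factor.
Variables (X U V : lmodType A).

Definition factors : {pred lhom U V} := fun f =>
  `[< exists (L : choiceType) (a : lhom U (dsum L X)) (b : lhom (dsum L X) V),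
        f = lhom_comp b a >].

Fact factors_closed : zmod_closed factors.
Proof.
split=> [|f g /asboolP[L [a [b ->]]] /asboolP[L' [a' [b' ->]]]]; apply/asboolP.
  by exists nat, 0, 0; apply: lhomP.
pose i k : lhom X (dsum (L + L')%type X) := dsum_inj X k.
pose j : lhom (dsum L X) (dsum (L + L')%type X) := dsum_lift (fun l => i (inl l)).
pose j' : lhom (dsum L' X) (dsum (L + L')%type X) := dsum_lift (fun l => i (inr l)).
pose b0 : lhom (dsum (L + L')%type X) V := dsum_lift (fun s => match s with
  | inl l => lhom_comp b (dsum_inj X l) | inr l => - lhom_comp b' (dsum_inj X l) end).
have bj : lhom_comp b0 j = b.
  apply: dsum_hom_ext => l x; rewrite -[LHS]/(b0 (j (dsum_inj X l x))).
  by rewrite /j dsum_lift_inj /i /b0 dsum_lift_inj.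
have bj' : lhom_comp b0 j' = - b'.
  apply: dsum_hom_ext => l x; rewrite -[LHS]/(b0 (j' (dsum_inj X l x))).
  by rewrite /j' dsum_lift_inj /i /b0 dsum_lift_inj.
exists (L + L')%type, (lhom_comp j a + lhom_comp j' a'), b0; apply: lhomP => x /=.
rewrite linearD -[b0 (j _)]/(lhom_comp b0 j _) -[b0 (j' _)]/(lhom_comp b0 j' _).
by rewrite bj bj'.
Qed.
HB.instance Definition _ := GRing.isZmodClosed.Build (lhom U V) factors factors_closed.

End Factor.
End AddCategories.
Arguments factors {A} X U V f : rename.

(* Add(M)/J_X has the same objects as Add(M); its morphisms U -> V form the
   quotient group Hom(U, V)/J_X(U, V). *)
Section QuotientCategory.
Variables (A : pzRingType) (X : lmodType A).
Implicit Types U V W : lmodType A.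

Definition homJ U V : Type := @Quotient.quot (lhom U V) (factors X U V).
HB.instance Definition _ U V := EqQuotient.on (homJ U V).
HB.instance Definition _ U V := GRing.Zmodule.on (homJ U V).

Definition homJ_pi U V (f : lhom U V) : homJ U V :=
  \pi_(@Quotient.quot (lhom U V) (factors X U V)) f.
Definition homJ_id U : homJ U U := homJ_pi (lhom_id U).
Definition homJ_comp U V W (g : homJ V W) (f : homJ U V) : homJ U W :=
  homJ_pi (lhom_comp (repr g) (repr f)).

Lemma homJ_piP U V (f g : lhom U V) : homJ_pi f = homJ_pi g <-> f - g \in factors X U V.
Proof.
rewrite /homJ_pi.
by split => [/eqP|/= fg]; [|apply/eqP]; rewrite -Quotient.idealrBE.
Qed.

Lemma homJ_repr U V (f : homJ U V) : homJ_pi (repr f) = f.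
Proof. exact: reprK. Qed.

Lemma homJ_comp_pi U V W (g : lhom V W) (f : lhom U V) :
  homJ_comp (homJ_pi g) (homJ_pi f) = homJ_pi (lhom_comp g f).
Proof.
apply/homJ_piP; set g' := repr _; set f' := repr _.
have /homJ_piP/asboolP[L [a [b gE]]] : homJ_pi g' = homJ_pi g by rewrite homJ_repr.
have /homJ_piP/asboolP[L' [a' [b' fE]]] : homJ_pi f' = homJ_pi f by rewrite homJ_repr.
rewrite (_ : _ - _ = lhom_comp (g' - g) f' + lhom_comp g (f' - f)); last first.
  apply: lhomP => x; rewrite /= -[RHS]/((g' (f' x) - g (f' x)) + g (f' x - f x)).
  by rewrite linearB addrA subrK.
by rewrite gE fE rpredD //; apply/asboolP;
  [exists L, (lhom_comp a f'), b|exists L', a', (lhom_comp g b')]; exact: lhomP.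
Qed.

Definition homJ_iso U V (f : homJ U V) :=
  exists g : homJ V U, homJ_comp g f = homJ_id U /\ homJ_comp f g = homJ_id V.

End QuotientCategory.

(* Two-sided ideals, and the quotient ring S/I.  The ideals of ring_quotient are
   proper ideals of commutative rings, while I = S must be allowed here. *)
HB.mixin Record isTwoSided (S : pzRingType) (I : {pred S}) := {
  idealMl : forall a, {in I, forall x, a * x \in I};
  idealMr : forall a, {in I, forall x, x * a \in I}
}.
#[short(type="ideal")]
HB.structure Definition Ideal (S : pzRingType) :=
  {I of GRing.ZmodClosed S I & isTwoSided S I}.

Section QuotientRing.
Variables (S : pzRingType) (I : ideal S).

Definition quotring : Type := @Quotient.quot S I.
HB.instance Definition _ := EqQuotient.on quotring.
HB.instance Definition _ := GRing.Zmodule.on quotring.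

Definition quotring_pi (s : S) : quotring := \pi_(@Quotient.quot S I) s.

Lemma quotring_piP s t : quotring_pi s = quotring_pi t <-> s - t \in I.
Proof.
rewrite /quotring_pi.
by split => [/eqP|/= uv]; [|apply/eqP]; rewrite -Quotient.idealrBE.
Qed.
Lemma quotring_repr (x : quotring) : quotring_pi (repr x) = x.
Proof. exact: reprK. Qed.
Lemma quotring_piD : {morph quotring_pi : s t / s + t}.
Proof. by move=> s t; rewrite /quotring_pi raddfD. Qed.

Definition quotring_mul (x y : quotring) : quotring := quotring_pi (repr x * repr y).
Lemma quotring_piM : {morph quotring_pi : s t / s * t >-> quotring_mul s t}.
Proof.
move=> s t; apply/quotring_piP; set s' := repr _; set t' := repr _.
have sI : s - s' \in I by apply/quotring_piP; rewrite quotring_repr.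
have tI : t - t' \in I by apply/quotring_piP; rewrite quotring_repr.
rewrite (_ : _ - _ = (s - s') * t + s' * (t - t')).
  by apply: rpredD; [exact: idealMr|exact: idealMl].
by rewrite mulrBl mulrBr addrA subrK.
Qed.

Fact quotring_mulA : associative quotring_mul.
Proof.
move=> x y z; rewrite -(quotring_repr x) -(quotring_repr y) -(quotring_repr z).
by rewrite -!quotring_piM mulrA.
Qed.
Fact quotring_mul1 : left_id (quotring_pi 1) quotring_mul.
Proof. by move=> x; rewrite -(quotring_repr x) -quotring_piM mul1r. Qed.
Fact quotring_mulr1 : right_id (quotring_pi 1) quotring_mul.
Proof. by move=> x; rewrite -(quotring_repr x) -quotring_piM mulr1. Qed.
Fact quotring_mulDl : left_distributive quotring_mul +%R.
Proof.
move=> x y z; rewrite -(quotring_repr x) -(quotring_repr y) -(quotring_repr z).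
by rewrite -quotring_piD -!quotring_piM mulrDl quotring_piD.
Qed.
Fact quotring_mulDr : right_distributive quotring_mul +%R.
Proof.
move=> x y z; rewrite -(quotring_repr x) -(quotring_repr y) -(quotring_repr z).
by rewrite -quotring_piD -!quotring_piM mulrDr quotring_piD.
Qed.
HB.instance Definition _ := GRing.Zmodule_isPzRing.Build quotring
  quotring_mulA quotring_mul1 quotring_mulr1 quotring_mulDl quotring_mulDr.

(* The action of S on the left of the right S/I-module S/I. *)
Definition quotring_lmul_fun (s : S) (x : rregular quotring) : rregular quotring :=
  (quotring_pi s : quotring) * (x : quotring).
Fact quotring_lmul_linear s : linear (quotring_lmul_fun s).
Proof.
move=> a x y; rewrite /quotring_lmul_fun -[a *: x]/((x : quotring) * (a : quotring)).
rewrite -[a *: _]/((quotring_pi s * (x : quotring)) * (a : quotring)).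
by rewrite -mulrA mulrDr.
Qed.
HB.instance Definition _ s := GRing.isLinear.Build quotring^c (rregular quotring)
  (rregular quotring) _ (quotring_lmul_fun s) (quotring_lmul_linear s).
Definition quotring_lmul (s : S) : Endo (rregular quotring) := quotring_lmul_fun s.
Fact quotring_lmul_zmod : zmod_morphism quotring_lmul.
Proof.
move=> s t; apply: lhomP => x; rewrite /= /quotring_lmul_fun.
rewrite -[RHS]/(quotring_pi s * (x : quotring) - quotring_pi t * (x : quotring)).
by rewrite -mulrBl /quotring_pi raddfB.
Qed.
Fact quotring_lmul_monoid : monoid_morphism quotring_lmul.
Proof.
split=> [|s t]; apply: lhomP => x; rewrite /= /quotring_lmul_fun.
  exact: (mul1r (x : quotring)).
rewrite quotring_piM -[RHS]/(quotring_pi s * (quotring_pi t * (x : quotring))).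
by rewrite mulrA.
Qed.
HB.instance Definition _ := GRing.isZmodMorphism.Build S (Endo (rregular quotring))
  quotring_lmul quotring_lmul_zmod.
HB.instance Definition _ := GRing.isMonoidMorphism.Build S (Endo (rregular quotring))
  quotring_lmul quotring_lmul_monoid.

End QuotientRing.

(* The submodule PI and the right S/I-module P/PI. *)
Section Reduction.
Variables (S : pzRingType) (I : ideal S) (P : rmodType S).

Definition mul_ideal : set P :=
  [set x | exists2 s : S, s \in I & exists p : P, x = (s : S^c) *: p]%classic.

Definition reduction : Type := quotmod mul_ideal.
HB.instance Definition _ := GRing.Zmodule.on reduction.

Definition reduction_scale (a : (quotring I)^c) (x : reduction) : reduction :=
  (repr (a : quotring I) : S^c) *: (x : quotmod mul_ideal).

Lemma reduction_scale_pi (s : S) (x : reduction) :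
  reduction_scale (quotring_pi I s) x = (s : S^c) *: (x : quotmod mul_ideal).
Proof.
rewrite /reduction_scale -(quotmod_repr x) -!linearZ; apply/quotmod_piP.
rewrite -scalerBl; apply/asboolP => U _; apply; eexists; last by exists (repr x).
by apply/quotring_piP; rewrite quotring_repr.
Qed.

Fact reduction_scaleA a b x :
  reduction_scale a (reduction_scale b x) = reduction_scale (a * b) x.
Proof.
rewrite -(quotring_repr a) -(quotring_repr b).
rewrite -[_ * _]/(quotring_mul (quotring_pi I (repr b)) (quotring_pi I (repr a))).
by rewrite -quotring_piM !reduction_scale_pi scalerA.
Qed.
Fact reduction_scale1 : left_id 1 reduction_scale.
Proof.
by move=> x; rewrite (reduction_scale_pi 1) (scale1r (x : quotmod mul_ideal)).
Qed.
Fact reduction_scaleDr : right_distributive reduction_scale +%R.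
Proof. by move=> a x y; exact: (scalerDr _ (x : quotmod mul_ideal)). Qed.
Fact reduction_scaleDl x : {morph reduction_scale^~ x : a b / a + b}.
Proof.
move=> a b; rewrite -(quotring_repr a) -(quotring_repr b).
rewrite -[(_ + _ : (quotring I)^c)]/(quotring_pi I (repr a) + quotring_pi I (repr b)).
by rewrite -quotring_piD !reduction_scale_pi (scalerDl (x : quotmod mul_ideal)).
Qed.
HB.instance Definition _ := GRing.Zmodule_isLmodule.Build (quotring I)^c reduction
  reduction_scaleA reduction_scale1 reduction_scaleDr reduction_scaleDl.

End Reduction.
Arguments mul_ideal {S} I P x : rename.
Arguments reduction {S} I P.

(* P (x)_S B for a right S-module P and an S-A-bimodule B, given as an A-module
   with a ring morphism from S to its endomorphism ring. *)
Section Tensor.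
Variables (S A : pzRingType) (B : lmodType A) (rho : {rmorphism S -> Endo B}).

Definition pure_gen (P : rmodType S) (p : P) (b : B) : dsum (P * B)%type A^o :=
  dsum_inj A^o (p, b) 1.

Definition tensor_rel (P : rmodType S) : set (dsum (P * B)%type A^o) := [set t |
  [\/ exists p p' b, t = pure_gen (p + p') b - (pure_gen p b + pure_gen p' b),
      exists p b b', t = pure_gen p (b + b') - (pure_gen p b + pure_gen p b'),
      exists p (s : S) b, t = pure_gen ((s : S^c) *: p) b - pure_gen p (rho s b)
    | exists p (a : A) b, t = pure_gen p (a *: b) - a *: pure_gen p b]]%classic.

Definition tensor (P : rmodType S) : lmodType A := quotmod (@tensor_rel P).

Section Map.
Variables (P P' : rmodType S) (f : lhom P P').

Definition scale_gen_fun (W : lmodType A) (w : W) (a : A^o) : W := (a : A) *: w.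
Fact scale_gen_linear (W : lmodType A) (w : W) : linear (scale_gen_fun w).
Proof. by move=> a x y; rewrite /scale_gen_fun scalerDl scalerA. Qed.
HB.instance Definition _ (W : lmodType A) (w : W) := GRing.isLinear.Build A A^o W _
  (scale_gen_fun w) (scale_gen_linear w).
Definition scale_gen (W : lmodType A) (w : W) : lhom A^o W := scale_gen_fun w.

Definition tensor_lift : lhom (dsum (P * B)%type A^o) (dsum (P' * B)%type A^o) :=
  dsum_lift (fun pb => scale_gen (pure_gen (f pb.1) pb.2)).

Lemma tensor_lift_pure p b : tensor_lift (pure_gen p b) = pure_gen (f p) b.
Proof. by rewrite [LHS]dsum_lift_inj /= /scale_gen_fun scale1r. Qed.

Lemma tensor_lift_rel t : tensor_rel t -> tensor_lift t \in mspan (@tensor_rel P').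
Proof.
move=> tP; apply/asboolP => U _; apply.
case: tP => [[p [p' [b ->]]]|[p [b [b' ->]]]|[p [s [b ->]]]|[p [a [b ->]]]];
  rewrite linearB.
- rewrite [in X in _ - X]linearD !tensor_lift_pure.
  by apply: Or41; exists (f p), (f p'), b; rewrite linearD.
- rewrite [in X in _ - X]linearD !tensor_lift_pure.
  by apply: Or42; exists (f p), b, b'.
- rewrite !tensor_lift_pure.
  by apply: Or43; exists (f p), s, b; rewrite linearZ.
- rewrite [in X in _ - X]linearZ !tensor_lift_pure.
  by apply: Or44; exists (f p), a, b.
Qed.

Definition tensor_map : lhom (tensor P) (tensor P') := quotmod_map tensor_lift_rel.
End Map.

End Tensor.

Definition projective (S : pzRingType) (P : rmodType S) := in_Add (rregular S) P.

Section BigProjectives.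
Variable S : pzRingType.

(* The sum of the images of the f : P -> S_S. *)
Definition trace (P : rmodType S) : {pred rregular S} :=
  mspan [set x | exists (f : lhom P (rregular S)) (p : P), x = f p]%classic.

Definition trace_ideal (I : ideal S) := exists P : rmodType S,
  [/\ count_gen P, projective P & forall s : S, (s \in I) = (s \in trace P)].

Definition is_big (I : ideal S) (P : rmodType S) := forall Q : rmodType S,
  count_gen Q -> projective Q -> (forall q : Q, q \in mspan (mul_ideal I Q)) ->
  exists f : lhom P Q, forall q, exists p, q = f p.

End BigProjectives.

(* Isomorphism classes are represented by the predicates [iso_class N], which
   are equal exactly when the modules are isomorphic. *)
Section IsoClasses.
Variable A : pzRingType.

Definition mod_class := lmodType A -> Prop.
Definition iso_class (N : lmodType A) : mod_class := fun N' => mod_iso N N'.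
Definition class_add (C D : mod_class) : mod_class := fun N =>
  exists U V, [/\ C U, D V & mod_iso (U * V)%type N].

Lemma mod_iso_refl (U : lmodType A) : mod_iso U U.
Proof. by exists (lhom_id U); exists id. Qed.

Lemma mod_iso_sym (U V : lmodType A) : mod_iso U V -> mod_iso V U.
Proof.
case=> f [g fK gK]; have lin : linear g.
  by move=> a x y; apply: (can_inj fK); rewrite linearP !gK.
pose gL := GRing.isLinear.Build A V U _ g lin.
pose h : {linear V -> U} := HB.pack g gL.
by exists h; exists f.
Qed.

Lemma mod_iso_trans (U V W : lmodType A) : mod_iso U V -> mod_iso V W -> mod_iso U W.
Proof. by case=> f fb [g gb]; exists (lhom_comp g f); exact: bij_comp. Qed.

Lemma iso_classP (U V : lmodType A) : iso_class U = iso_class V <-> mod_iso U V.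
Proof.
split=> [UV|UV]; first by rewrite -/(iso_class U V) UV; exact: mod_iso_refl.
apply/funext => W; apply/propext; split; last exact: mod_iso_trans.
exact/mod_iso_trans/mod_iso_sym.
Qed.

Lemma class_add_iso (U V : lmodType A) :
  class_add (iso_class U) (iso_class V) = iso_class (U * V)%type.
Proof.
apply/funext => W; apply/propext; split; last first.
  by exists U, V; split => //; exact: mod_iso_refl.
case=> U' [V' [[f [f' fK f'K]] [g [g' gK g'K]] UVW]]; apply: mod_iso_trans UVW.
pose h (x : U * V) : U' * V' := (f x.1, g x.2).
have hlin : linear h by move=> a x y; rewrite /h /= !linearP.
pose hL := GRing.isLinear.Build A (U * V)%type (U' * V')%type _ h hlin.
pose hh : {linear (U * V)%type -> (U' * V')%type} := HB.pack h hL.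
exists hh; exists (fun y => (f' y.1, g' y.2)) => [[x y]|[x y]] /=.
  by rewrite /h /= fK gK.
by rewrite /h /= f'K g'K.
Qed.

Definition class_zero : mod_class := fun N => forall x : N, x = 0.

(* V(M) and V^*(M) *)
Definition V_fin (M : lmodType A) : mod_class -> Prop := fun C =>
  exists2 N, in_add M N & C = iso_class N.
Definition V_count (M : lmodType A) : mod_class -> Prop := fun C =>
  exists2 N, in_Addc M N & C = iso_class N.

Definition is_subsemigroup (T B : mod_class -> Prop) :=
  (forall C, B C -> T C) /\ (forall C D, B C -> B D -> B (class_add C D)).
Definition is_submonoid (T B : mod_class -> Prop) :=
  is_subsemigroup T B /\ B class_zero.

End IsoClasses.

Section Alpha.
Variables (R : pzRingType) (M : rmodType R).
Notation S := (Endo M).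

(* P (x)_S M, with S = Endo M acting on M by evaluation *)
Definition tensor_M (P : rmodType S) : rmodType R :=
  tensor (idfun : {rmorphism S -> Endo M}) P.

(* The functor Hom(M, -) (x)_S S/I, and the map it induces on morphisms of
   Add(M)/J_X. *)
Definition homM_obj (I : ideal S) (N : rmodType R) : rmodType (quotring I) :=
  tensor (quotring_lmul I) (lhom M N : rmodType S).
Definition homM_map (I : ideal S) (N N' : rmodType R) (f : lhom N N') :
    lhom (homM_obj I N) (homM_obj I N') :=
  tensor_map (quotring_lmul I) (lhom_post M f).
Definition homM_mapJ (I : ideal S) (X N N' : rmodType R) (f : homJ X N N') :
    lhom (homM_obj I N) (homM_obj I N') :=
  homM_map I (repr f).

(* iota_I [P'] is the class of the countably generated I-big projective P with
   P/PI isomorphic to P'; alpha_I is its composition with - (x)_S M. *)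
Definition iota_class (I : ideal S) (C : mod_class (quotring I)^c) : mod_class S^c :=
  fun P => exists2 P', C P' &
    [/\ count_gen P, projective P, is_big I P & mod_iso (reduction I P) P'].
Definition tensor_class (C : mod_class S^c) : mod_class R^c :=
  fun N => exists2 P, C P & mod_iso (tensor_M P) N.
Definition alpha (I : ideal S) (C : mod_class (quotring I)^c) : mod_class R^c :=
  tensor_class (iota_class C).

Definition alpha_image (I : ideal S) : mod_class R^c -> Prop := fun C =>
  exists2 D, V_fin (rregular (quotring I)) D & C = alpha D.

Definition B_set : mod_class R^c -> Prop := fun C =>
  exists I : ideal S,
    [/\ trace_ideal I, (exists2 s, s \in I & s != 0) & alpha_image I C].

End Alpha.

(* The data of a functor to a quotient category modulo J_X.  It is required to
   be functorial only on projective modules, that is on Add(S/I). *)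
Record functorJ (T R : pzRingType) (X : rmodType R) := FunctorJ {
  fobj :> rmodType T -> rmodType R;
  fmap : forall Q Q' : rmodType T, lhom Q Q' -> homJ X (fobj Q) (fobj Q')
}.

Section InverseEquivalence.
Variables (R : pzRingType) (M : rmodType R) (I : ideal (Endo M)) (X : rmodType R).
Variable G : functorJ (quotring I) X.

Definition is_functor :=
  [/\ forall Q, projective Q -> in_Add M (G Q),
      forall Q, projective Q -> fmap G (lhom_id Q) = homJ_id X (G Q)
    & forall Q Q' Q'' (g : lhom Q' Q'') (f : lhom Q Q'),
        projective Q -> projective Q' -> projective Q'' ->
        fmap G (lhom_comp g f) = homJ_comp (fmap G g) (fmap G f)].

(* G : Add(S/I) -> Add(M)/J_X is a quasi-inverse of the functor F induced by
   Hom(M, -) (x)_S S/I: there are natural isomorphisms F G Q -> Q and G F N -> N. *)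
Definition inverse_equivalence :=
  is_functor /\
  exists (eta : forall Q : rmodType (quotring I), lhom (homM_obj I (G Q)) Q)
         (eps : forall N : rmodType R, homJ X (G (homM_obj I N)) N),
  [/\ forall Q, projective Q -> bijective (eta Q),
      forall Q Q' (g : lhom Q Q'), projective Q -> projective Q' ->
        lhom_comp (eta Q') (homM_mapJ I (fmap G g)) = lhom_comp g (eta Q),
      forall N, in_Add M N -> homJ_iso (eps N)
    & forall N N' (f : homJ X N N'), in_Add M N -> in_Add M N' ->
        homJ_comp (eps N') (fmap G (homM_mapJ I f)) = homJ_comp f (eps N)].

Definition preserves_count_gen :=
  forall Q : rmodType (quotring I), projective Q -> count_gen Q -> count_gen (G Q).

End InverseEquivalence.

(* Main.v *)
Require Import Defs.
From HB Require Import structures.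
From mathcomp Require Import all_boot all_order all_algebra.
From mathcomp Require Import generic_quotient ring_quotient.
From mathcomp Require Import boolp classical_sets functions cardinality fsbigop.

Set Implicit Arguments.
Unset Strict Implicit.
Unset Printing Implicit Defensive.

Import GRing.Theory.
Local Open Scope ring_scope.

(** Write S = End(M) and H = Hom(M, -).  The category Add(M) and that of the
    projective S-modules are two pictures of one category.  As M is finitely
    generated, a homomorphism from M to a direct sum has finitely many nonzero
    components; hence H is full and faithful on Add(M) ([hom_full],
    [hom_faithful]), evaluation H(N) (x) M -> N is invertible ([eval_iso]), and
    every projective P is H(P (x) M) ([retract_regular_tensor]).  The countably
    generated objects of Add(M) are the retracts of M^(w) ([in_AddcP]), and one
    works with retracts throughout.

    Now put W = X_I^(w) and consider reduction modulo I, which sends N to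
    H(N)/H(N)I.  Since H(N) is projective, homomorphisms between reductions lift;
    since I is the trace of H(X_I), an endomorphism that is the identity modulo I
    differs from the identity by a map factoring through W ([red_id_thru]).  So an
    isomorphism of reductions yields f : N -> N' and g : N' -> N for which 1 - gf
    and 1 - fg factor through W.  Then N is a summand of N' + W whose complement
    is a summand of W, and as W absorbs its summands by the Eilenberg swindle,
    N + W and N' + W are isomorphic ([iso_absorb], [red_iso_absorb]).  This is the
    uniqueness of I-big projectives: H(N + W) is I-big ([big_hom_prod]), and
    conversely H(N) being I-big forces W to be a summand of N, so that
    N = N + W ([big_hom_retract], [retract_absorbed]).  Consequently alpha_I sends
    the class of H(N)/H(N)I to the class of N + W for every N in the countable
    part of Add(M) ([alpha_eq]).  Applied to N = G_I(Q) this is (i), and applied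
    to N = Y it gives (ii), because the reduction of Y is a finitely generated
    projective S/I-module exactly when Y is in add(M + W) ([alpha_imageP]).

    Finally, if Y lies in the image of alpha_I and Z in that of alpha_J, then Y + Z
    lies in the image of alpha_K, where K = I + J is the trace of H(X_I + X_J):
    by (ii) one only has to compare X_K^(w) with X_I^(w) + X_J^(w), and each of
    two modules of Add(M) with the same trace is a summand of a countable power of
    the other ([trace_sub_retract], [alpha_image_prod]).  A class in the image of
    alpha_I has X_I^(w) as a summand, which is not finitely generated unless
    X_I = 0, that is unless I = 0; whence (iii) and (iv). *)

(** * Linear maps, retracts and direct summands *)

Section LinearMaps.
Variable A : pzRingType.
Implicit Types U V W : lmodType A.

Definition mk_lhom U V (f : U -> V) (lin : linear f) : lhom U V :=
  HB.pack f (GRing.isLinear.Build A U V _ f lin).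

(* The lemmas below restate the linearity lemmas for [lhom], so that rewriting
   leaves the map in the form in which it was given. *)
Lemma lhom0 U V (f : lhom U V) : f 0 = 0. Proof. exact: linear0. Qed.
Lemma lhomD U V (f : lhom U V) x y : f (x + y) = f x + f y.
Proof. exact: linearD. Qed.
Lemma lhomB U V (f : lhom U V) x y : f (x - y) = f x - f y.
Proof. exact: linearB. Qed.
Lemma lhomZ U V (f : lhom U V) a x : f (a *: x) = a *: f x.
Proof. exact: linearZ. Qed.
Lemma lhomP_lin U V (f : lhom U V) a x y : f (a *: x + y) = a *: f x + f y.
Proof. exact: linearP. Qed.
Lemma lhom_sum U V (f : lhom U V) I (r : seq I) P F :
  f (\sum_(i <- r | P i) F i) = \sum_(i <- r | P i) f (F i).
Proof. exact: linear_sum. Qed.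

Lemma lhom_compA U V W W' (f : lhom W W') (g : lhom V W) (h : lhom U V) :
  lhom_comp (lhom_comp f g) h = lhom_comp f (lhom_comp g h).
Proof. exact: lhomP. Qed.

Lemma lhom_eq U V (f g : lhom U V) : f = g -> f =1 g.
Proof. by move->. Qed.

Lemma mod_isoI U V (f : lhom U V) (g : lhom V U) :
  cancel f g -> cancel g f -> mod_iso U V.
Proof. by exists f; exists g. Qed.

Lemma mod_isoE U V : mod_iso U V ->
  exists (f : lhom U V) (g : lhom V U), cancel f g /\ cancel g f.
Proof.
case=> f [g fK gK]; have lin : linear g.
  by move=> a x y; apply: (can_inj fK); rewrite linearP !gK.
by exists f, (mk_lhom lin).
Qed.

Section Products.
Variables U V W : lmodType A.

Fact pr1_linear : linear (fun x : U * V => x.1). Proof. by []. Qed.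
Fact pr2_linear : linear (fun x : U * V => x.2). Proof. by []. Qed.
Definition pr1 : lhom (U * V)%type U := mk_lhom pr1_linear.
Definition pr2 : lhom (U * V)%type V := mk_lhom pr2_linear.

Section Pair.
Variables (f : lhom W U) (g : lhom W V).
Fact pair_linear : linear (fun x : W => (f x, g x)).
Proof. by move=> a x y; rewrite !linearP. Qed.
Definition lpair : lhom W (U * V)%type := mk_lhom pair_linear.
End Pair.

Section Copair.
Variables (f : lhom U W) (g : lhom V W).
Fact copair_linear : linear (fun x : U * V => f x.1 + g x.2).
Proof. by move=> a x y; rewrite /= !linearP scalerDr addrACA. Qed.
Definition lcopair : lhom (U * V)%type W := mk_lhom copair_linear.
End Copair.

End Products.

Definition in1 U V : lhom U (U * V)%type := lpair (lhom_id U) 0.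
Definition in2 U V : lhom V (U * V)%type := lpair 0 (lhom_id V).

Definition lprod U V U' V' (f : lhom U U') (g : lhom V V') :
    lhom (U * V)%type (U' * V')%type :=
  lpair (lhom_comp f (pr1 U V)) (lhom_comp g (pr2 U V)).

Lemma mod_iso_prod U V U' V' :
  mod_iso U U' -> mod_iso V V' -> mod_iso (U * V)%type (U' * V')%type.
Proof.
move=> /mod_isoE[f [f' [fK f'K]]] /mod_isoE[g [g' [gK g'K]]].
by apply: (@mod_isoI _ _ (lprod f g) (lprod f' g')) => -[x y] /=;
  rewrite ?fK ?gK ?f'K ?g'K.
Qed.

Lemma mod_iso_prodC U V : mod_iso (U * V)%type (V * U)%type.
Proof.
by apply: (@mod_isoI _ _ (lpair (pr2 U V) (pr1 U V)) (lpair (pr2 V U) (pr1 V U)));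
  case.
Qed.

Lemma mod_iso_prodA U V W : mod_iso (U * (V * W))%type (U * V * W)%type.
Proof.
pose f : lhom (U * (V * W))%type (U * V * W)%type :=
  lpair (lprod (lhom_id U) (pr1 V W)) (lhom_comp (pr2 V W) (pr2 U _)).
pose g : lhom (U * V * W)%type (U * (V * W))%type :=
  lpair (lhom_comp (pr1 U V) (pr1 _ W)) (lprod (pr2 U V) (lhom_id W)).
by apply: (@mod_isoI _ _ f g); [case=> x []|case=> -[]].
Qed.

Definition retract U V :=
  exists (i : lhom U V) (p : lhom V U), cancel i p.

Lemma iso_retract U V : mod_iso U V -> retract U V.
Proof. by move/mod_isoE => [f [g [fK _]]]; exists f, g. Qed.

Lemma retract_refl U : retract U U.
Proof. exact/iso_retract/mod_iso_refl. Qed.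

Lemma retract_trans U V W : retract U V -> retract V W -> retract U W.
Proof.
move=> [i [p ip]] [j [q jq]]; exists (lhom_comp j i), (lhom_comp p q).
by move=> x /=; rewrite jq ip.
Qed.

Lemma retract_prod U V U' V' :
  retract U U' -> retract V V' -> retract (U * V)%type (U' * V')%type.
Proof.
move=> [i [p ip]] [j [q jq]]; exists (lprod i j), (lprod p q).
by case=> x y /=; rewrite ip jq.
Qed.

Lemma retract_l U V : retract U (U * V)%type.
Proof. by exists (in1 U V), (pr1 U V). Qed.

Lemma retract_r U V : retract V (U * V)%type.
Proof. by exists (in2 U V), (pr2 U V). Qed.

Lemma iso_prod_retract U V W : mod_iso (U * V)%type W -> retract U W.
Proof. by move/iso_retract; apply: retract_trans (retract_l U V). Qed.

Definition qpi V (X : set V) : lhom V (quotmod X) :=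
  mk_lhom (@quotmod_pi_linear A V X).

Lemma qpiP V (X : set V) u v : qpi X u = qpi X v <-> u - v \in mspan X.
Proof. exact: quotmod_piP. Qed.

Lemma qpi_eq0 V (X : set V) v : qpi X v = 0 <-> v \in mspan X.
Proof. by rewrite -(linear0 (qpi X)) qpiP subr0. Qed.

Lemma qpi_repr V (X : set V) (x : quotmod X) : qpi X (repr x) = x.
Proof. exact: quotmod_repr. Qed.

Lemma mem_mspan V (X : set V) v : X v -> v \in mspan X.
Proof. by move=> Xv; apply/asboolP => U _; apply. Qed.

Lemma mspan_ind V (X : set V) (P : V -> Prop) : P 0 ->
  (forall a u v, P u -> P v -> P (a *: u + v)) -> (forall x, X x -> P x) ->
  forall v, v \in mspan X -> P v.
Proof.
move=> P0 PD PX v /asboolP/(_ (fun v => `[< P v >])) vP; apply/asboolP/vP.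
  by split=> [|a x y /asboolP Px /asboolP Py]; apply/asboolP => //; apply: PD.
by move=> x /PX Px; apply/asboolP.
Qed.

(** The complement is the cokernel of the inclusion i, which 1 - ip embeds back
    into V. *)
Lemma retract_complement U V (i : lhom U V) (p : lhom V U) : cancel i p ->
  exists (C : lmodType A) (c : lhom V C) (s : lhom C V),
    [/\ cancel s c, forall v, s (c v) = v - i (p v) & mod_iso (U * C)%type V].
Proof.
move=> ip; pose C := quotmod (range i).
pose c : lhom V C := qpi (range i).
pose e : lhom V V := lhom_id V - lhom_comp i p.
have eE v : e v = v - i (p v) by [].
have e0 v : v \in mspan (range i) -> e v = 0.
  move: v; apply: mspan_ind; first exact: linear0.
    by move=> a x y ex ey; rewrite linearP ex ey scaler0 addr0.
  by move=> x [u _ <-]; rewrite eE ip subrr.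
have slin : linear (fun x : C => e (repr x)).
  move=> a x y; rewrite -linearP; apply/eqP; rewrite -subr_eq0 -linearB; apply/eqP.
  by apply: e0; apply/qpiP; rewrite linearP !qpi_repr.
pose s : lhom C V := mk_lhom slin.
have sc v : s (c v) = e v.
  apply/eqP; rewrite -[s _]/(e (repr (c v))) -subr_eq0 -linearB; apply/eqP/e0/qpiP.
  by rewrite qpi_repr.
have ci u : c (i u) = 0 by apply/qpi_eq0/mem_mspan; exists u.
have cs : cancel s c.
  by move=> x; rewrite -(qpi_repr x) -/c sc eE linearB ci subr0.
clearbody s c; exists C, c, s; split => //.
apply: (@mod_isoI _ _ (lcopair i s) (lpair p c)) => [[u x]|v]; last first.
  by rewrite -[LHS]/(i (p v) + s (c v)) sc eE addrC subrK.
rewrite -[LHS]/(p (i u + s x), c (i u + s x)) !linearD ip ci cs add0r.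
suff -> : p (s x) = 0 by rewrite addr0.
by rewrite -(cs x) sc eE linearB ip subrr.
Qed.

Lemma retractP U V : retract U V <-> exists C : lmodType A, mod_iso (U * C)%type V.
Proof.
split=> [[i [p /retract_complement[C [_ [_ [_ _ iso]]]]]]|[C]].
  by exists C.
exact: iso_prod_retract.
Qed.

End LinearMaps.

(** * Countable direct sums and the Eilenberg swindle *)

Section DirectSums.
Variable A : pzRingType.
Implicit Types U V W X : lmodType A.

Section Coordinates.
Variables (L : choiceType) (V : lmodType A).

Fact dsum_proj_linear (l : L) : linear (fun f : dsum L V => f l).
Proof. by []. Qed.
Definition dsum_proj l : lhom (dsum L V) V := mk_lhom (dsum_proj_linear l).

Lemma dsum_proj_inj l v : dsum_proj l (dsum_inj V l v) = v.
Proof. by rewrite /= /dsum_inj_raw eqxx. Qed.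

Lemma dsum_proj_inj0 k l v : k <> l -> dsum_proj k (dsum_inj V l v) = 0.
Proof. by rewrite /= /dsum_inj_raw; case: eqP. Qed.

Lemma dsum_supp_seq (f : dsum L V) : exists s : seq L, forall l, f l <> 0 -> l \in s.
Proof.
have /finite_seqP[s sE] := dsum_supp f; exists s => l fl.
by have : [set` s]%classic l by rewrite -sE.
Qed.

Lemma dsum_decomp_seq (f : dsum L V) (s : seq L) : uniq s ->
  (forall l, f l <> 0 -> l \in s) -> f = \sum_(l <- s) dsum_inj V l (dsum_proj l f).
Proof.
move=> us sP; apply: dsumP => k; rewrite -[RHS]/(dsum_proj k _) lhom_sum.
have [ks|nks] := boolP (k \in s).
  rewrite (bigD1_seq k) // dsum_proj_inj big1 => [|l /eqP lk].
    by rewrite [RHS]addr0.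
  by apply: dsum_proj_inj0 => kl; apply: lk.
have -> : f k = 0 by apply: contrapT => /sP; rewrite (negPf nks).
rewrite big_seq big1 // => l ls; apply: dsum_proj_inj0 => kl.
by rewrite kl ls in nks.
Qed.

Lemma dsum_mk (h : L -> V) (s : seq L) : (forall l, h l <> 0 -> l \in s) ->
  exists f : dsum L V, forall l, f l = h l.
Proof.
move=> hs; have hfin : fin_supp h by apply/asboolP/(sub_finite_set _ (finite_seq s)).
by exists (DSum hfin).
Qed.

End Coordinates.

Definition dsum_map (L : choiceType) U V (f : L -> lhom U V) : lhom (dsum L U) (dsum L V) :=
  dsum_lift (fun l => lhom_comp (dsum_inj V l) (f l)).

Lemma dsum_map_inj (L : choiceType) U V (f : L -> lhom U V) l u :
  dsum_map f (dsum_inj U l u) = dsum_inj V l (f l u).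
Proof. by rewrite dsum_lift_inj. Qed.

Lemma lhom_eq_id U (f : lhom U U) : f = lhom_id U -> forall x, f x = x.
Proof. by move->. Qed.

Lemma retract_dsum (L : choiceType) U V : retract U V -> retract (dsum L U) (dsum L V).
Proof.
move=> [i [p ip]]; exists (dsum_map (fun=> i)), (dsum_map (fun=> p)).
apply: (@lhom_eq_id _ (lhom_comp (dsum_map (fun=> p)) (dsum_map (fun=> i)))).
by apply: dsum_hom_ext => l x; rewrite -[LHS]/(dsum_map _ (dsum_map _ _)) !dsum_map_inj ip.
Qed.

Lemma retract_dsum1 (L : choiceType) (l : L) V : retract V (dsum L V).
Proof. by exists (dsum_inj V l), (dsum_proj V l) => v; exact: dsum_proj_inj. Qed.

Lemma dsum_nat_idem X : mod_iso (dsum nat (dsum nat X)) (dsum nat X).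
Proof.
have [e [e' eK e'K]] : exists e : nat * nat -> nat, bijective e.
  by have /card_set_bijP[e] := card_nat2; rewrite setTT_bijective; exists e.
pose f : lhom (dsum nat (dsum nat X)) (dsum nat X) :=
  dsum_lift (fun i => dsum_lift (fun j => dsum_inj X (e (i, j)))).
pose g : lhom (dsum nat X) (dsum nat (dsum nat X)) :=
  dsum_lift (fun n => lhom_comp (dsum_inj _ (e' n).1) (dsum_inj X (e' n).2)).
have fE i j x : f (dsum_inj _ i (dsum_inj X j x)) = dsum_inj X (e (i, j)) x.
  by rewrite !dsum_lift_inj.
have gE n x : g (dsum_inj X n x) = dsum_inj _ (e' n).1 (dsum_inj X (e' n).2 x).
  by rewrite dsum_lift_inj.
clearbody f g; apply: (@mod_isoI _ _ _ f g).
  apply: (@lhom_eq_id _ (lhom_comp g f)); apply: dsum_hom_ext => i y.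
  rewrite -[LHS]/(lhom_comp (lhom_comp g f) (dsum_inj _ i) y).
  rewrite -[RHS]/(dsum_inj _ i y); apply: (@lhom_eq _ _ _ _ (dsum_inj _ i)).
  by apply: dsum_hom_ext => j x; rewrite [LHS]/= fE gE eK.
apply: (@lhom_eq_id _ (lhom_comp f g)); apply: dsum_hom_ext => n x.
by rewrite [LHS]/= gE fE -surjective_pairing e'K.
Qed.

Lemma dsum_prod (L : choiceType) U V :
  mod_iso (dsum L (U * V)%type) (dsum L U * dsum L V)%type.
Proof.
pose f : lhom (dsum L (U * V)%type) (dsum L U * dsum L V)%type :=
  lpair (dsum_map (fun=> pr1 U V)) (dsum_map (fun=> pr2 U V)).
pose g : lhom (dsum L U * dsum L V)%type (dsum L (U * V)%type) :=
  lcopair (dsum_map (fun=> in1 U V)) (dsum_map (fun=> in2 U V)).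
have fE l x : f (dsum_inj _ l x) = (dsum_inj _ l x.1, dsum_inj _ l x.2).
  by rewrite [LHS]/= !dsum_lift_inj.
have g1E l u : g (dsum_inj _ l u, 0) = dsum_inj _ l (u, 0).
  by rewrite -[LHS]/(dsum_map _ _ + dsum_map _ _) lhom0 addr0 dsum_lift_inj.
have g2E l v : g (0, dsum_inj _ l v) = dsum_inj _ l (0, v).
  by rewrite -[LHS]/(dsum_map _ _ + dsum_map _ _) lhom0 add0r dsum_lift_inj.
clearbody f g; apply: (@mod_isoI _ _ _ f g).
  apply: (@lhom_eq_id _ (lhom_comp g f)); apply: dsum_hom_ext => l [u v].
  rewrite -[LHS]/(g (f _)) fE /=.
  have -> : (dsum_inj U l u, dsum_inj V l v) =
            (dsum_inj U l u, 0) + (0, dsum_inj V l v) :> (dsum L U * dsum L V)%type.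
    by rewrite -[RHS]/(_ + _, _ + _) addr0 add0r.
  rewrite lhomD g1E g2E -lhomD -[(u, 0) + _]/(u + 0, 0 + v).
  by rewrite addr0 add0r.
case=> x y; rewrite -[LHS]/(lhom_comp f g (x, y)).
have -> : (x, y) = in1 _ _ x + in2 _ _ y :> (dsum L U * dsum L V)%type.
  by rewrite -[RHS]/(x + 0, 0 + y) addr0 add0r.
rewrite lhomD; congr (_ + _).
  rewrite -[LHS]/(lhom_comp (lhom_comp f g) (in1 _ _) x); apply: lhom_eq.
  by apply: dsum_hom_ext => l u; rewrite -[LHS]/(f (g _)) g1E fE /= lhom0.
rewrite -[LHS]/(lhom_comp (lhom_comp f g) (in2 _ _) y); apply: lhom_eq.
by apply: dsum_hom_ext => l u; rewrite -[LHS]/(f (g _)) g2E fE /= lhom0.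
Qed.

(** If V = U + C, then U + V^(w) and V^(w) are the same sequence of copies of U
    and C up to a shift of the copies of U.  The shift is written with the
    idempotent [lhom_comp i p], so that no complement C has to be chosen. *)
Lemma swindle U V : retract U V -> mod_iso (U * dsum nat V)%type (dsum nat V).
Proof.
move=> [i [p ip]].
have [e eE] : exists e : lhom V V, forall v, e v = v - i (p v).
  by exists (lhom_id V - lhom_comp i p).
have ei u : e (i u) = 0 by rewrite eE ip subrr.
have pe v : p (e v) = 0 by rewrite eE lhomB ip subrr.
have ee v : e (e v) = e v by rewrite eE pe lhom0 subr0.
pose inj := @dsum_inj _ V nat.
(* f moves the U-part of each term one place to the right, putting the extra
   copy of U in place 0; g moves it back. *)
pose f : lhom (U * dsum nat V)%type (dsum nat V) := lcopair
  (lhom_comp (inj 0%N) i)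
  (dsum_lift (fun n => lhom_comp (inj n) e + lhom_comp (inj n.+1) (lhom_comp i p))).
pose g : lhom (dsum nat V) (U * dsum nat V)%type := dsum_lift (fun n =>
  if n is n'.+1 then
    lpair 0 (lhom_comp (inj n) e + lhom_comp (inj n') (lhom_comp i p))
  else lpair p (lhom_comp (inj 0%N) e)).
have f1E u : f (u, 0) = inj 0%N (i u).
  by rewrite -[LHS]/(inj 0%N (i u) + dsum_lift _ _) lhom0 addr0.
have f2E n v : f (0, inj n v) = inj n (e v) + inj n.+1 (i (p v)).
  rewrite -[LHS]/(inj 0%N (i 0) + dsum_lift _ _) !lhom0 add0r.
  by rewrite dsum_lift_inj.
have g0E v : g (inj 0%N v) = (p v, inj 0%N (e v)) by rewrite [LHS]dsum_lift_inj.
have gSE n v : g (inj n.+1 v) = (0, inj n.+1 (e v) + inj n (i (p v))).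
  by rewrite [LHS]dsum_lift_inj.
clearbody f g; apply: (@mod_isoI _ _ _ f g).
  case=> u x; rewrite -[LHS]/(lhom_comp g f (u, x)).
  have -> : (u, x) = in1 _ _ u + in2 _ _ x :> (U * dsum nat V)%type.
    by rewrite -[RHS]/(u + 0, 0 + x) addr0 add0r.
  rewrite lhomD; congr (_ + _).
    by rewrite -[LHS]/(g (f (u, 0))) f1E g0E ip ei lhom0.
  rewrite -[LHS]/(lhom_comp (lhom_comp g f) (in2 _ _) x); apply: lhom_eq.
  apply: dsum_hom_ext => n v; rewrite -[LHS]/(g (f (0, inj n v))) f2E lhomD.
  rewrite gSE ei ip lhom0 add0r.
  have -> : g (inj n (e v)) = (0, inj n (e v)).
    by case: n => [|n]; rewrite ?g0E ?gSE pe ee // !lhom0 addr0.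
  rewrite -[LHS]/(0 + 0, _ + _) addr0 -(lhomD (inj n)) eE subrK.
  by [].
apply: (@lhom_eq_id _ (lhom_comp f g)); apply: dsum_hom_ext => n v.
rewrite -[LHS]/(f (g (inj n v))) -[RHS]/(inj n v).
have fD u x : f (u, x) = inj 0%N (i u) + f (0, x).
  rewrite -f1E -lhomD; congr (f _).
  by rewrite -[RHS]/(u + 0, 0 + x) addr0 add0r.
case: n => [|n].
  by rewrite g0E fD f2E pe !lhom0 addr0 ee -(lhomD (inj _)) eE addrC subrK.
rewrite gSE -[_ + inj _ _]/(_ + _).
have -> : (0, inj n.+1 (e v) + inj n (i (p v))) =
   (0, inj n.+1 (e v)) + (0, inj n (i (p v))) :> (U * dsum nat V)%type.
  by rewrite -[RHS]/(0 + 0, _ + _) addr0.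
by rewrite lhomD !f2E ee pe ei !lhom0 addr0 add0r ip -(lhomD (inj _)) eE subrK.
Qed.

Lemma dsum_nat_absorb U X : retract U (dsum nat X) ->
  mod_iso (U * dsum nat X)%type (dsum nat X).
Proof.
move/swindle => iso; apply: mod_iso_trans (mod_iso_trans iso (dsum_nat_idem X)).
by apply: mod_iso_prod; [exact: mod_iso_refl|exact/mod_iso_sym/dsum_nat_idem].
Qed.

Lemma dsum_nat_double X : mod_iso (dsum nat X * dsum nat X)%type (dsum nat X).
Proof. exact/dsum_nat_absorb/retract_refl. Qed.

Lemma retract_absorbed Y X : retract (dsum nat X) Y ->
  mod_iso (Y * dsum nat X)%type Y.
Proof.
move=> /retractP[C isoY]; apply: (mod_iso_trans _ isoY).
apply: mod_iso_trans (mod_iso_prod (mod_iso_sym isoY) (mod_iso_refl _)) _.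
apply: mod_iso_trans (mod_iso_prodC _ _) _.
apply: mod_iso_trans (mod_iso_prodA _ _ _) _.
exact: mod_iso_prod (dsum_nat_double X) (mod_iso_refl C).
Qed.

Definition factors_thru W U V (f : lhom U V) := exists (a : lhom U W) (b : lhom W V),
  forall x, f x = b (a x).

(** An isomorphism modulo the maps through W = X^(w) becomes a true isomorphism
    after adding W: U is a summand of V + W by (f, a), and the complementary
    idempotent of V + W factors through W, so the complement is a summand of W
    and is absorbed by it. *)
Lemma iso_absorb X U V (f : lhom U V) (g : lhom V U) :
  factors_thru (dsum nat X) (lhom_id U - lhom_comp g f) ->
  factors_thru (dsum nat X) (lhom_id V - lhom_comp f g) ->
  mod_iso (U * dsum nat X)%type (V * dsum nat X)%type.
Proof.
set W := dsum nat X => -[a [b ab]] [a' [b' ab']].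
have abE x : b (a x) = x - g (f x) by rewrite -ab.
have ab'E x : b' (a' x) = x - f (g x) by rewrite -ab'.
have ip : cancel (lpair f a) (lcopair g b).
  by move=> u; rewrite -[LHS]/(g (f u) + b (a u)) abE addrC subrK.
have [C [c [s [cs sc iso]]]] := retract_complement ip.
pose al : lhom (V * W)%type (W * (W * W))%type :=
  lpair (lhom_comp a' (pr1 V W))
        (lpair (pr2 V W) (pr2 V W - lhom_comp a (lcopair g b))).
pose be : lhom (W * (W * W))%type (V * W)%type :=
  lpair (lhom_comp b' (pr1 _ _) - lhom_comp f (lhom_comp b (lhom_comp (pr1 _ _) (pr2 _ _))))
        (lhom_comp (pr2 _ _) (pr2 _ _)).
(* The complementary idempotent 1 - (f, a)(g, b), factored through W^3: its
   V-component is (1 - fg) - fb = b' a' - f b. *)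
have beal x : be (al x) = x - lpair f a (lcopair g b x).
  case: x => v w.
  rewrite -[LHS]/(b' (a' v) - f (b w), w - a (g v + b w)).
  rewrite -[RHS]/(v - f (g v + b w), w - a (g v + b w)).
  by rewrite ab'E (lhomD f) opprD addrA.
have CW : retract C W.
  apply: (@retract_trans _ _ (W * (W * W))%type).
    exists (lhom_comp al s), (lhom_comp c be) => x.
    by rewrite -[LHS]/(c (be (al (s x)))) beal -sc !cs.
  apply: iso_retract; apply: mod_iso_trans (dsum_nat_double X).
  exact: mod_iso_prod (mod_iso_refl W) (dsum_nat_double X).
apply: mod_iso_trans (mod_iso_prod (mod_iso_refl U) (mod_iso_sym (dsum_nat_absorb CW))) _.
apply: mod_iso_trans (mod_iso_prodA _ _ _) _.
apply: mod_iso_trans (mod_iso_prod iso (mod_iso_refl W)) _.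
apply: mod_iso_trans (mod_iso_sym (mod_iso_prodA _ _ _)) _.
exact: mod_iso_prod (mod_iso_refl V) (dsum_nat_double X).
Qed.

End DirectSums.

(** * Finite and countable generation *)

Section Generation.
Variable A : pzRingType.
Implicit Types U V W X M N : lmodType A.

Definition generates V (X : set V) := forall v, v \in mspan X.

Lemma mspan_sub V (X Y : set V) : (forall x, X x -> x \in mspan Y) ->
  forall v, v \in mspan X -> v \in mspan Y.
Proof.
move=> XY; apply: mspan_ind => [|a u v uY vY|]; first exact: rpred0.
  by rewrite rpredD ?rpredZ.
exact: XY.
Qed.

Lemma generates_sub V (X Y : set V) : generates X ->
  (forall x, X x -> x \in mspan Y) -> generates Y.
Proof. by move=> genX XY v; apply: mspan_sub XY _ (genX v). Qed.

Lemma fin_genI V (T : finType) (u : T -> V) : generates (range u) -> fin_gen V.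
Proof.
move=> genu; exists #|T|, (u \o enum_val); apply: generates_sub genu _.
by move=> _ [t _ <-]; apply: mem_mspan; exists (enum_rank t); rewrite //= enum_rankK.
Qed.

Lemma count_genI V (T : countType) (u : T -> V) : generates (range u) -> count_gen V.
Proof.
move=> genu; exists (fun n => if unpickle n is Some t then u t else 0).
apply: generates_sub genu _ => _ [t _ <-]; apply: mem_mspan.
by exists (pickle t); rewrite ?pickleK.
Qed.

Lemma fin_count_gen V : fin_gen V -> count_gen V.
Proof. by move=> [n [u genu]]; apply: count_genI genu. Qed.

Lemma generates_surj V W (f : lhom V W) (X : set V) (Y : set W) :
  (forall w, exists v, w = f v) -> (forall x, X x -> f x \in mspan Y) ->
  generates X -> generates Y.
Proof. by move=> fs fXY genX w; have [v ->] := fs w; apply: span_map (genX v). Qed.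

Lemma count_gen_surj V W (f : lhom V W) :
  (forall w, exists v, w = f v) -> count_gen V -> count_gen W.
Proof.
move=> fs [u genu]; exists (f \o u); apply: generates_surj fs _ genu.
by move=> _ [n _ <-]; apply: mem_mspan; exists n.
Qed.

Lemma fin_gen_surj V W (f : lhom V W) :
  (forall w, exists v, w = f v) -> fin_gen V -> fin_gen W.
Proof.
move=> fs [k [u genu]]; exists k, (f \o u); apply: generates_surj fs _ genu.
by move=> _ [n _ <-]; apply: mem_mspan; exists n.
Qed.

Lemma generates_dsum (L : choiceType) V T (u : T -> V) : generates (range u) ->
  generates (range (fun lt : L * T => dsum_inj V lt.1 (u lt.2))).
Proof.
move=> genu f; have [s sf] := dsum_supp_seq f.
rewrite (@dsum_decomp_seq _ _ _ f (undup s) (undup_uniq s)); last first.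
  by move=> l /sf; rewrite mem_undup.
apply: rpred_sum => l _; apply: span_map (genu _) => _ [t _ <-].
by apply: mem_mspan; exists (l, t).
Qed.

Lemma fin_gen_dsum (L : finType) V : fin_gen V -> fin_gen (dsum L V).
Proof. by move=> [n [u /generates_dsum gen]]; apply: fin_genI (gen L). Qed.

Lemma count_gen_dsum (L : countType) V : count_gen V -> count_gen (dsum L V).
Proof. by move=> [u /generates_dsum gen]; apply: count_genI (gen L). Qed.

Lemma retract_count_gen U V : retract U V -> count_gen V -> count_gen U.
Proof. by move=> [i [p ip]]; apply: (count_gen_surj (f := p)) => u; exists (i u). Qed.

Lemma retract_fin_gen U V : retract U V -> fin_gen V -> fin_gen U.
Proof. by move=> [i [p ip]]; apply: (fin_gen_surj (f := p)) => u; exists (i u). Qed.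

Lemma generates_supp (L : choiceType) V W (X : set V) (f : lhom V (dsum L W)) (D : set L) :
  generates X -> (forall x l, X x -> f x l <> 0 -> D l) ->
  forall v l, f v l <> 0 -> D l.
Proof.
move=> genX XD v l; apply: contra_notP => nDl; move: v (genX v).
apply: mspan_ind => [|a u v fu fv|x Xx]; first by rewrite lhom0.
  by rewrite lhomP_lin -[LHS]/(a *: f u l + f v l) fu fv scaler0 addr0.
by apply: contra_notP nDl => /(XD _ _ Xx).
Qed.

(** The summands met by the images of the generators suffice. *)
Lemma fin_gen_supp (L : choiceType) V W (f : lhom V (dsum L W)) : fin_gen V ->
  exists2 s : seq L, uniq s & forall v l, f v l <> 0 -> l \in s.
Proof.
move=> [n [u genu]]; pose F i := [set l | f (u i) l <> 0]%classic.
have /finite_seqP[s sE] : finite_set (\bigcup_(i in setT) F i)%classic.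
  by apply: bigcup_finite => // i _; exact: dsum_supp.
exists (undup s); rewrite ?undup_uniq // => v l fvl; rewrite mem_undup.
suff : [set` s]%classic l by [].
rewrite -sE; apply: generates_supp genu _ v l fvl => _ k [i _ <-] fk.
by exists i.
Qed.

Lemma fin_gen_decomp (L : choiceType) V W (f : lhom V (dsum L W)) : fin_gen V ->
  exists s : seq L, forall v, f v = \sum_(l <- s) dsum_inj W l (dsum_proj W l (f v)).
Proof.
by case/(fin_gen_supp f) => s us sP; exists s => v; apply: dsum_decomp_seq (sP v).
Qed.

Lemma count_gen_supp (L : choiceType) V W (f : lhom V (dsum L W)) : count_gen V ->
  exists2 D : set L, countable D & forall v l, f v l <> 0 -> D l.
Proof.
move=> [u genu]; exists (\bigcup_(i in setT) [set l | f (u i) l <> 0])%classic.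
  by apply: bigcup_countable => // i _; exact/finite_set_countable/dsum_supp.
by apply: generates_supp genu _ => _ k [i _ <-] fk; exists i.
Qed.

(** A numbering of D moves the summands indexed by D into W^(nat). *)
Lemma retract_countable_supp (L : choiceType) V W (D : set L)
    (i : lhom V (dsum L W)) (p : lhom (dsum L W) V) : cancel i p ->
  countable D -> (forall v l, i v l <> 0 -> D l) -> retract V (dsum nat W).
Proof.
move=> ip /countable_injP[c cinj] iD.
(* A left inverse of the numbering c on D; [None] is used at the numbers which
   c does not reach. *)
pose g n : option L := if pselect (exists2 l, D l & c l = n) is left w
  then Some (xget (projT1 (cid2 w)) [set l | D l /\ c l = n]%classic) else None.
have gK l : D l -> g (c l) = Some l.
  rewrite /g => Dl; case: pselect => [w|[]]; last by exists l.
  congr Some; case: xgetP => [k -> [Dk ckl]|/(_ l)[]//].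
  by apply: cinj; rewrite ?inE.
pose j : lhom (dsum L W) (dsum nat W) := dsum_lift (fun l => dsum_inj W (c l)).
pose q : lhom (dsum nat W) (dsum L W) :=
  dsum_lift (fun n => if g n is Some l then dsum_inj W l else 0).
have jE l x : j (dsum_inj W l x) = dsum_inj W (c l) x by rewrite dsum_lift_inj.
have qE l x : D l -> q (dsum_inj W (c l) x) = dsum_inj W l x.
  by move=> Dl; rewrite dsum_lift_inj gK.
clearbody j q; exists (lhom_comp j i), (lhom_comp p q) => v.
rewrite -[RHS]ip -[LHS]/(p (q (j (i v)))); congr (p _).
have [s sP] := dsum_supp_seq (i v).
pose s' := [seq l <- undup s | `[< D l >]].
rewrite [in RHS](@dsum_decomp_seq _ _ _ (i v) s') ?filter_uniq ?undup_uniq //; last first.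
  move=> l il; rewrite mem_filter mem_undup (sP _ il) andbT.
  by apply/asboolP/iD/il.
rewrite [in LHS](@dsum_decomp_seq _ _ _ (i v) s') ?filter_uniq ?undup_uniq //; last first.
  move=> l il; rewrite mem_filter mem_undup (sP _ il) andbT.
  by apply/asboolP/iD/il.
rewrite !lhom_sum; apply: eq_big_seq => l; rewrite mem_filter => /andP[/asboolP Dl _].
by rewrite jE qE.
Qed.

Lemma in_addP U V : in_add U V <-> exists n, retract V (dsum 'I_n U).
Proof.
split=> [[n [W iso]]|[n /retractP[W iso]]]; exists n; last by exists W.
exact: iso_prod_retract iso.
Qed.

Lemma in_AddP U V : in_Add U V <-> exists L : choiceType, retract V (dsum L U).
Proof.
split=> [[L [W iso]]|[L /retractP[W iso]]]; exists L; last by exists W.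
exact: iso_prod_retract iso.
Qed.

(** A countably generated submodule meets only countably many summands of U^(L),
    and these can be numbered. *)
Lemma in_AddcP U V : count_gen U -> in_Addc U V <-> retract V (dsum nat U).
Proof.
move=> cU; split=> [[cV /in_AddP[L [i [p ip]]]]|VU].
  have [D cD iD] := count_gen_supp i cV.
  exact: retract_countable_supp ip cD iD.
by split; [exact: retract_count_gen VU (count_gen_dsum nat cU)|apply/in_AddP; exists nat].
Qed.

Lemma retract_ord_nat n U : retract (dsum 'I_n U) (dsum nat U).
Proof.
apply: (@retract_countable_supp 'I_n _ _ setT (lhom_id _) (lhom_id _)) => //.
exact: countableP.
Qed.

End Generation.

(** * The functor Hom(M, -) on Add(M) *)

Lemma lhom_sumE (A : pzRingType) (U V : lmodType A) I (r : seq I) (F : I -> lhom U V) x :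
  (\sum_(i <- r) F i) x = \sum_(i <- r) F i x.
Proof. by elim/big_rec2: _ => //= i y f _ <-. Qed.

Section HomFunctor.
Variables (A : pzRingType) (M : lmodType A).
Implicit Types N V W : lmodType A.
Notation S := (Endo M).
Notation H N := (lhom M N : lmodType S^c).

Lemma hom_postZ N B (F : lhom (H N) B) (s : S) (h : lhom M N) :
  F (lhom_comp h s) = (s : S^c) *: F h.
Proof. exact: (lhomZ F). Qed.

Lemma retract_hom N N' : retract N N' -> retract (H N) (H N').
Proof.
move=> [i [p ip]]; exists (lhom_post M i), (lhom_post M p) => h.
by apply: lhomP => m; exact: ip.
Qed.

Lemma hom_regular : mod_iso (H M) (rregular S).
Proof.
have lin : linear (fun s : lhom M M => (s : rregular S)) by [].
have lin' : linear (fun s : rregular S => (s : lhom M M)) by [].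
exact: (@mod_isoI _ (H M) (rregular S) (@mk_lhom _ (H M) (rregular S) _ lin)
  (@mk_lhom _ (rregular S) (H M) _ lin')).
Qed.

Hypothesis M_fg : fin_gen M.

(** The dual basis of a retract N of M^(L): the maps p inj_l generate Hom(M, N)
    over the endomorphisms of M, with coefficients proj_l i h, of which only
    finitely many are nonzero as M is finitely generated. *)
Lemma hom_decomp (L : choiceType) N (i : lhom N (dsum L M)) (p : lhom (dsum L M) N)
    (h : lhom M N) : cancel i p -> exists s : seq L,
  h = \sum_(l <- s) lhom_comp (lhom_comp p (dsum_inj M l))
          (lhom_comp (dsum_proj M l) (lhom_comp i h)) /\
  forall m, i (h m) = \sum_(l <- s) dsum_inj M l (dsum_proj M l (i (h m))).
Proof.
move=> ip; have [s sE] := fin_gen_decomp (lhom_comp i h) M_fg; exists s; split=> //.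
by apply: lhomP => m; rewrite lhom_sumE -[LHS]ip -[i _]/(lhom_comp i h m) sE lhom_sum.
Qed.

(** The map f is forced to be F (p inj_l) on the l-th summand of M^(L), and it
    induces F because F is linear over the endomorphisms of M. *)
Lemma hom_full (L : choiceType) N N' (F : lhom (H N) (H N')) : retract N (dsum L M) ->
  exists f : lhom N N', forall h, F h = lhom_comp f h.
Proof.
move=> [i [p ip]].
exists (lhom_comp (dsum_lift (fun l => F (lhom_comp p (dsum_inj M l)))) i) => h.
have [s [hE ihE]] := hom_decomp h ip; rewrite {1}hE (lhom_sum F).
apply: lhomP => m; rewrite lhom_sumE -[RHS]/(dsum_lift _ (i (h m))) ihE lhom_sum.
by apply: eq_bigr => l _; rewrite hom_postZ dsum_lift_inj.
Qed.

Lemma hom_faithful (L : choiceType) N N' (f g : lhom N N') : retract N (dsum L M) ->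
  (forall h : lhom M N, lhom_comp f h = lhom_comp g h) -> f = g.
Proof.
move=> [i [p ip]] fg; apply: lhomP => x; rewrite -(ip x).
apply: (@lhom_eq _ _ _ (lhom_comp f p) (lhom_comp g p)).
apply: dsum_hom_ext => l m.
exact: (lhom_eq (fg (lhom_comp p (dsum_inj M l))) m).
Qed.

(** The finite generation of M makes Hom(M, -) commute with direct sums. *)
Lemma hom_dsum (L : choiceType) V : mod_iso (H (dsum L V)) (dsum L (H V)).
Proof.
have fex (h : lhom M (dsum L V)) : exists f : dsum L (H V),
    forall l, f l = lhom_comp (dsum_proj V l) h.
  have [s _ sh] := fin_gen_supp h M_fg.
  apply: (@dsum_mk _ _ (H V) (fun l => lhom_comp (dsum_proj V l) h) s) => l hl.
  apply: contrapT => /negP ls; apply: hl; apply: lhomP => m.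
  apply: contrapT => hm; move/negP: ls; apply; exact: sh hm.
have [f fE] := choice fex.
have flin : linear (f : H (dsum L V) -> dsum L (H V)).
  move=> a g h; apply: dsumP => l; rewrite -[RHS]/(a *: f g l + f h l) !fE.
  by apply: lhomP.
pose F : lhom (H (dsum L V)) (dsum L (H V)) := mk_lhom flin.
pose G : lhom (dsum L (H V)) (H (dsum L V)) :=
  dsum_lift (fun l => lhom_post M (dsum_inj V l)).
have FE h l : F h l = lhom_comp (dsum_proj V l) h by exact: fE.
have GE l h : G (dsum_inj (H V) l h) = lhom_comp (dsum_inj V l) h.
  by rewrite dsum_lift_inj.
clearbody F G; apply: (@mod_isoI _ _ _ F G) => [h|].
  have [s us sh] := fin_gen_supp h M_fg.
  have Fs l : F h l <> 0 -> l \in s.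
    rewrite FE => hl; apply: contrapT => /negP ls; apply: hl; apply: lhomP => m.
    by apply: contrapT => hm; move/negP: ls; apply; exact: sh hm.
  rewrite (@dsum_decomp_seq _ _ _ (F h) s us Fs) lhom_sum.
  apply: lhomP => m; rewrite lhom_sumE [RHS](@dsum_decomp_seq _ _ _ (h m) s us (sh m)).
  by apply: eq_bigr => l _; rewrite GE -[dsum_proj _ _ _]/(F h l) FE.
apply: (@lhom_eq_id _ _ (lhom_comp F G)); apply: dsum_hom_ext => l h.
rewrite -[LHS]/(F (G _)) GE; apply: dsumP => k; rewrite FE /= /dsum_inj_raw.
apply: lhomP => m; rewrite /= /dsum_inj_raw.
by case: eqP.
Qed.

Lemma hom_projective L N : retract N (dsum L M) -> projective (H N).
Proof.
move=> NL; apply/in_AddP; exists L.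
apply: retract_trans (retract_hom NL) (retract_trans (iso_retract (hom_dsum L M)) _).
exact/retract_dsum/iso_retract/hom_regular.
Qed.

Lemma fin_gen_regular (B : pzRingType) : fin_gen (rregular B).
Proof.
apply: (@fin_genI B^c (rregular B) unit (fun=> (1 : B))) => x.
have -> : x = (x : B^c) *: ((1 : B) : rregular B).
  by rewrite -[RHS]/((1 : B) * (x : B)) mul1r.
by apply: rpredZ; apply: mem_mspan; exists tt.
Qed.

Lemma hom_count_gen N : retract N (dsum nat M) -> count_gen (H N).
Proof.
move=> NL.
apply: retract_count_gen (count_gen_dsum nat (fin_count_gen (fin_gen_regular S))).
apply: retract_trans (retract_hom NL) (retract_trans (iso_retract (hom_dsum nat M)) _).
exact/retract_dsum/iso_retract/hom_regular.
Qed.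

End HomFunctor.

(** * Tensor products and the inverse of Hom(M, -) *)

Section TensorProducts.
Variables (S A : pzRingType) (B : lmodType A) (rho : {rmorphism S -> Endo B}).
Implicit Types P : rmodType S.
Implicit Types W : lmodType A.

Definition pure P (p : P) (b : B) : tensor rho P :=
  qpi (@tensor_rel _ _ _ rho P) (pure_gen p b).

Lemma pureDl P (p p' : P) b : pure (p + p') b = pure p b + pure p' b.
Proof.
rewrite /pure -lhomD; apply/qpiP/mem_mspan; apply: Or41.
by exists p, p', b.
Qed.

Lemma pureDr P (p : P) b b' : pure p (b + b') = pure p b + pure p b'.
Proof.
rewrite /pure -lhomD; apply/qpiP/mem_mspan; apply: Or42.
by exists p, b, b'.
Qed.

Lemma pureS P (p : P) (s : S) b : pure ((s : S^c) *: p) b = pure p (rho s b).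
Proof. by apply/qpiP/mem_mspan; apply: Or43; exists p, s, b. Qed.

Lemma pureZ P (p : P) (a : A) b : pure p (a *: b) = a *: pure p b.
Proof. by rewrite /pure -lhomZ; apply/qpiP/mem_mspan; apply: Or44; exists p, a, b. Qed.

Fact pure_linear P (p : P) : linear (pure p).
Proof. by move=> a b b'; rewrite pureDr pureZ. Qed.
Definition lpure P (p : P) : lhom B (tensor rho P) := mk_lhom (pure_linear p).

Lemma pure_suml P I (r : seq I) (F : I -> P) b :
  pure (\sum_(i <- r) F i) b = \sum_(i <- r) pure (F i) b.
Proof.
have pure0 : pure (0 : P) b = 0.
  by apply: (addrI (pure 0 b)); rewrite -pureDl !addr0.
by elim: r => [|i r IH]; rewrite ?big_nil // !big_cons pureDl IH.
Qed.

Lemma tensor_ext P W (f g : lhom (tensor rho P) W) :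
  (forall p b, f (pure p b) = g (pure p b)) -> f =1 g.
Proof.
move=> fg x; rewrite -(qpi_repr x).
apply: (@lhom_eq _ _ _ (lhom_comp f (qpi _)) (lhom_comp g (qpi _))).
apply: dsum_hom_ext => -[p b] a.
have -> : dsum_inj A^o (p, b) a = (a : A) *: pure_gen p b.
  by rewrite /pure_gen -lhomZ; congr (dsum_inj _ _ _); rewrite -[RHS]/(a * 1) mulr1.
by rewrite !lhomZ; congr (_ *: _); exact: fg.
Qed.

Lemma tensor_univ P W (beta : P -> B -> W) :
  (forall p p' b, beta (p + p') b = beta p b + beta p' b) ->
  (forall p, linear (beta p)) ->
  (forall p (s : S) b, beta ((s : S^c) *: p) b = beta p (rho s b)) ->
  exists f : lhom (tensor rho P) W, forall p b, f (pure p b) = beta p b.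
Proof.
move=> bD bL bS.
pose f0 : lhom (dsum (P * B)%type A^o) W :=
  dsum_lift (fun pb => scale_gen (beta pb.1 pb.2)).
have f0E p b : f0 (pure_gen p b) = beta p b.
  by rewrite /f0 /pure_gen dsum_lift_inj -[LHS]/((1 : A) *: beta p b) scale1r.
clearbody f0.
have f0r t : t \in mspan (@tensor_rel _ _ _ rho P) -> f0 t = 0.
  move: t; apply: mspan_ind => [|a u v fu fv|t]; first exact: lhom0.
    by rewrite lhomP_lin fu fv scaler0 addr0.
  case=> [[p [p' [b ->]]]|[p [b [b' ->]]]|[p [s [b ->]]]|[p [a [b ->]]]];
    apply/eqP; rewrite lhomB ?(lhomD f0) ?(lhomZ f0) !f0E subr_eq0; apply/eqP.
  - exact: bD.
  - by have := bL p 1 b b'; rewrite !scale1r.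
  - exact: bS.
  - have := bL p a b 0; rewrite !addr0 => ->.
    suff -> : beta p 0 = 0 by rewrite addr0.
    by have := bL p 1 0 0; rewrite !scale1r addr0 => /(congr1 (fun x => x - beta p 0));
      rewrite subrr addrK.
have flin : linear (fun x : tensor rho P => f0 (repr x)).
  move=> a x y; rewrite -lhomP_lin; apply/eqP; rewrite -subr_eq0 -lhomB; apply/eqP.
  by apply: f0r; apply/qpiP; rewrite lhomP_lin !qpi_repr.
exists (mk_lhom flin) => p b; rewrite -[LHS]/(f0 (repr (pure p b))) -f0E.
by apply/eqP; rewrite -subr_eq0 -lhomB; apply/eqP/f0r/qpiP; rewrite qpi_repr.
Qed.

Lemma tensor_map_pure P P' (f : lhom P P') p b :
  tensor_map rho f (pure p b) = pure (f p) b.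
Proof.
transitivity (qpi (@tensor_rel _ _ _ rho P') (tensor_lift B f (pure_gen p b))).
  exact: (quotmod_map_pi (@tensor_lift_rel _ _ _ rho P P' f)).

by rewrite tensor_lift_pure.
Qed.

Lemma retract_tensor P P' : retract P P' -> retract (tensor rho P) (tensor rho P').
Proof.
move=> [i [p ip]]; exists (tensor_map rho i), (tensor_map rho p).
apply: (@tensor_ext _ _ (lhom_comp (tensor_map rho p) (tensor_map rho i)) (lhom_id _)).
by move=> x b; rewrite -[LHS]/(tensor_map _ _ (tensor_map _ _ _)) !tensor_map_pure ip.
Qed.

End TensorProducts.

Section EvaluationUnit.
Variables (R : pzRingType) (M : rmodType R).
Hypothesis M_fg : fin_gen M.
Implicit Types N : rmodType R.
Notation S := (Endo M).
Notation H N := (lhom M N : rmodType S).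
Notation rho := (idfun : {rmorphism S -> Endo M}).

(** With the dual basis of N, the inverse of evaluation is
    n |-> sum_l (p inj_l) (x) (proj_l i n). *)
Lemma eval_iso (L : choiceType) N : retract N (dsum L M) ->
  exists ev : lhom (tensor_M (H N)) N,
    (forall (h : lhom M N) (m : M), ev (pure rho (h : H N) m) = h m) /\ bijective ev.
Proof.
move=> [i [p ip]].
have [ev evE] : exists ev : lhom (tensor_M (H N)) N,
    forall (h : lhom M N) (m : M), ev (pure rho (h : H N) m) = h m.
  apply: (@tensor_univ _ _ _ rho (H N) _ (fun h m => (h : lhom M N) m)) => //.
  by move=> h a m m'; rewrite lhomP_lin.
exists ev; split=> //.
pose k : lhom N (tensor_M (H N)) := lhom_comp
  (dsum_lift (fun l => lpure rho (lhom_comp p (dsum_inj M l) : H N))) i.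
have kE n : k n = dsum_lift (fun l => lpure rho (lhom_comp p (dsum_inj M l) : H N)) (i n).
  by [].
clearbody k; exists k.
  apply: (@tensor_ext _ _ _ rho (H N) _ (lhom_comp k ev) (lhom_id _)) => h m.
  rewrite -[LHS]/(k (ev _)) evE kE.
  have [s [hE ihE]] := hom_decomp M_fg h ip.
  rewrite ihE lhom_sum -[RHS]/(pure rho (h : H N) m) {2}hE pure_suml.
  apply: eq_bigr => l _; rewrite dsum_lift_inj.
  rewrite -[LHS]/(pure rho (lhom_comp p (dsum_inj M l) : H N)
     (lhom_comp (dsum_proj M l) (lhom_comp i h) m)).
  by rewrite -(pureS rho (lhom_comp p (dsum_inj M l) : H N)).
move=> n; rewrite kE -[RHS]ip.
apply: (@lhom_eq _ _ _ (lhom_comp ev (dsum_lift _)) p).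
apply: dsum_hom_ext => l m; rewrite -[LHS]/(ev (dsum_lift _ _)) dsum_lift_inj.
by rewrite [LHS]evE.
Qed.

Lemma tensor_hom_iso (L : choiceType) N : retract N (dsum L M) ->
  mod_iso (tensor_M (H N)) N.
Proof. by case/eval_iso => ev [_ bev]; exists ev. Qed.

Definition tensor_unit_fun (P : rmodType S) (p : P) : H (tensor_M P) := lpure rho p.
Fact tensor_unit_linear P : linear (@tensor_unit_fun P).
Proof.
move=> a p q; apply: lhomP => m; rewrite -[LHS]/(pure rho (a *: p + q) m) pureDl.
by rewrite (pureS rho p (a : S) m).
Qed.
Definition tensor_unit P : lhom P (H (tensor_M P)) := mk_lhom (@tensor_unit_linear P).

(** The unit P -> Hom(M, P (x) M) is natural and is invertible for P of the form
    Hom(M, N) with N in Add(M), by a triangle identity; hence also for the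
    retracts of such P, which include all projective modules. *)
Lemma retract_regular_tensor (L : choiceType) P : retract P (dsum L (rregular S)) ->
  retract (tensor_M P) (dsum L M) /\ mod_iso P (H (tensor_M P)).
Proof.
move=> PL; have PH : retract P (H (dsum L M)).
  apply: retract_trans PL _.
  apply: retract_trans _ (iso_retract (mod_iso_sym (hom_dsum M_fg L M))).
  apply: retract_dsum.
  exact/iso_retract/mod_iso_sym/hom_regular.
have ML := retract_refl (dsum L M); split.
  apply: retract_trans (retract_tensor rho PH) _.
  exact/iso_retract/(tensor_hom_iso ML).
have [ev [evE [k evK kK]]] := eval_iso ML; have [i [p ip]] := PH.
have unat (P' P'' : rmodType S) (f : lhom P' P'') x :
    lhom_comp (tensor_map rho f) (tensor_unit P' x) = tensor_unit P'' (f x).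
  by apply: lhomP => m; exact: (tensor_map_pure rho f).
have evu h : lhom_comp ev (tensor_unit (H (dsum L M)) h) = h.
  by apply: lhomP => m; exact: evE.
have tip x : tensor_map rho p (tensor_map rho i x) = x.
  apply: (@tensor_ext _ _ _ rho _ _
    (lhom_comp (tensor_map rho p) (tensor_map rho i)) (lhom_id _)).
  by move=> y b; rewrite -[LHS]/(tensor_map _ _ (tensor_map _ _ _)) !tensor_map_pure ip.
exists (tensor_unit P).
exists (fun y => p (lhom_comp ev (lhom_comp (tensor_map rho i) y))) => [x|y].
  by rewrite unat evu ip.
rewrite -unat; apply: lhomP => m /=.
set z := lhom_comp ev _.
rewrite -[LHS]/(tensor_map rho p (tensor_unit _ z m)).
rewrite -[tensor_unit _ z m](evK) -[ev _]/(lhom_comp ev (tensor_unit _ z) m) evu.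
by rewrite /z -[lhom_comp _ _ m]/(ev (tensor_map rho i (y m))) evK tip.
Qed.

End EvaluationUnit.

(** * Reduction modulo an ideal *)

Section Reduction.
Variables (S : pzRingType) (I : ideal S).
Implicit Types P Q : rmodType S.
Notation T := (quotring I).

Definition PI P : {pred P} := mspan (mul_ideal I P).
Arguments PI : clear implicits.

Definition red_pi P (p : P) : reduction I P := qpi (mul_ideal I P) p.

Lemma red_piD P (p q : P) : red_pi (p + q) = red_pi p + red_pi q.
Proof. exact: lhomD (qpi _) _ _. Qed.

Lemma red_piZ P (s : S) (p : P) :
  red_pi ((s : S^c) *: p) = (quotring_pi I s : T^c) *: red_pi p.
Proof. by rewrite [RHS]reduction_scale_pi -[LHS]/(qpi _ _) lhomZ. Qed.

Lemma red_piP P (p q : P) : red_pi p = red_pi q <-> p - q \in PI P.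
Proof. exact: qpiP. Qed.

Lemma red_pi_repr P (x : reduction I P) :
  red_pi (repr (x : quotmod (mul_ideal I P))) = x.
Proof. exact: qpi_repr. Qed.

Lemma red_pi_sum P J (r : seq J) (F : J -> P) :
  red_pi (\sum_(i <- r) F i) = \sum_(i <- r) red_pi (F i).
Proof. exact: (lhom_sum (qpi (mul_ideal I P))). Qed.

Lemma PI_mul P (s : S) (p : P) : s \in I -> (s : S^c) *: p \in PI P.
Proof. by move=> sI; apply: mem_mspan; exists s => //; exists p. Qed.

Lemma PI_map P Q (f : lhom P Q) p : p \in PI P -> f p \in PI Q.
Proof.
apply: span_map => _ [s sI [x ->]]; rewrite lhomZ; exact: PI_mul.
Qed.

Lemma red_lift P (V : rmodType T) (F : P -> V) :
  (forall p q, F (p + q) = F p + F q) ->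
  (forall (s : S) p, F ((s : S^c) *: p) = (quotring_pi I s : T^c) *: F p) ->
  exists f : lhom (reduction I P) V, forall p, f (red_pi p) = F p.
Proof.
move=> FD FZ.
have F0 : F 0 = 0 by apply: (addrI (F 0)); rewrite -FD !addr0.
have FI p : p \in PI P -> F p = 0.
  move: p; apply: mspan_ind => [//|a p q Fp Fq|_ [s sI [p ->]]].
    by rewrite FD (FZ a) Fp Fq scaler0 addr0.
  rewrite FZ (_ : quotring_pi I s = quotring_pi I 0).
    have -> : quotring_pi I 0 = 0 by rewrite /quotring_pi raddf0.
    exact: scale0r.
  by apply/quotring_piP; rewrite subr0.
have Feq p q : red_pi p = red_pi q -> F p = F q.
  by move/red_piP/FI => pq; rewrite -(subrK q p) FD pq add0r.
pose f (x : reduction I P) : V := F (repr (x : quotmod (mul_ideal I P))).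
have fE p : f (red_pi p) = F p by apply: Feq; rewrite red_pi_repr.
have lin : linear f.
  move=> a x y; rewrite -(quotring_repr (a : T)) -(red_pi_repr x) -(red_pi_repr y).
  by rewrite -red_piZ -red_piD !fE FD FZ.
by exists (mk_lhom lin) => p; exact: fE.
Qed.

Lemma red_ext P (V : rmodType T) (f g : lhom (reduction I P) V) :
  (forall p, f (red_pi p) = g (red_pi p)) -> f =1 g.
Proof. by move=> fg x; rewrite -(red_pi_repr x). Qed.

Lemma red_map P Q (f : lhom P Q) :
  exists F : lhom (reduction I P) (reduction I Q), forall p, F (red_pi p) = red_pi (f p).
Proof.
by apply: (red_lift (F := fun p => red_pi (f p))) => [p q|s p];
  rewrite ?lhomD ?lhomZ ?red_piD ?red_piZ.
Qed.

Lemma red_retract P Q (f : lhom P Q) (g : lhom Q P) :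
  (forall p, p - g (f p) \in PI P) -> retract (reduction I P) (reduction I Q).
Proof.
move=> gf; have [F FE] := red_map f; have [G GE] := red_map g.
exists F, G; apply: (@red_ext _ _ (lhom_comp G F) (lhom_id _)) => p.
by rewrite -[LHS]/(G (F _)) FE GE; apply/esym/red_piP.
Qed.

Lemma red_iso P Q (f : lhom P Q) (g : lhom Q P) :
  (forall p, p - g (f p) \in PI P) -> (forall q, q - f (g q) \in PI Q) ->
  mod_iso (reduction I P) (reduction I Q).
Proof.
move=> gf fg; have [F FE] := red_map f; have [G GE] := red_map g.
apply: (@mod_isoI _ _ _ F G).
  apply: (@red_ext _ _ (lhom_comp G F) (lhom_id _)) => p.
  by rewrite -[LHS]/(G (F _)) FE GE; apply/esym/red_piP.
apply: (@red_ext _ _ (lhom_comp F G) (lhom_id _)) => p.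
by rewrite -[LHS]/(F (G _)) GE FE; apply/esym/red_piP.
Qed.

Lemma mod_iso_red P Q : mod_iso P Q -> mod_iso (reduction I P) (reduction I Q).
Proof.
move=> /mod_isoE[f [g [fK gK]]]; apply: (@red_iso _ _ f g) => x.
  by rewrite fK subrr rpred0.
by rewrite gK subrr rpred0.
Qed.

(** P (x) S/I = P/PI, by p (x) t |-> pt and p |-> p (x) 1. *)
Lemma tensor_red P : mod_iso (tensor (quotring_lmul I) P) (reduction I P).
Proof.
pose rho := quotring_lmul I.
have [f fE] : exists f : lhom (tensor rho P) (reduction I P),
    forall p (t : rregular T), f (pure rho p t) = ((t : T) : T^c) *: red_pi p.
  apply: (@tensor_univ _ _ _ rho P _
    (fun p (t : rregular T) => ((t : T) : T^c) *: red_pi p)).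
  - by move=> p p' t; rewrite red_piD scalerDr.
  - by move=> p a t t'; rewrite scalerDl scalerA.
  - by move=> p s t; rewrite red_piZ scalerA.
have [g gE] : exists g : lhom (reduction I P) (tensor rho P),
    forall p, g (red_pi p) = pure rho p ((1 : T) : rregular T).
  apply: red_lift => [p q|s p]; first exact: pureDl.
  rewrite pureS -pureZ; congr (pure _ _ _).
  rewrite -[LHS]/((quotring_pi I s : T) * (1 : T)) -[RHS]/((1 : T) * (quotring_pi I s : T)).
  by rewrite mulr1 mul1r.
apply: (@mod_isoI _ _ _ f g).
  apply: (@tensor_ext _ _ _ rho P _ (lhom_comp g f) (lhom_id _)) => p t.
  rewrite -[LHS]/(g (f _)) fE lhomZ gE -pureZ; congr (pure _ _ _).
  by rewrite -[LHS]/((1 : T) * (t : T)) mul1r.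
apply: (@red_ext _ _ (lhom_comp f g) (lhom_id _)) => p.
by rewrite -[LHS]/(f (g _)) gE fE -[RHS]scale1r.
Qed.

Lemma red_free (L : choiceType) :
  mod_iso (reduction I (dsum L (rregular S))) (dsum L (rregular T)).
Proof.
have fex (f : dsum L (rregular S)) : exists g : dsum L (rregular T),
    forall l, g l = quotring_pi I (f l).
  have [s sf] := dsum_supp_seq f.
  apply: (@dsum_mk _ _ (rregular T) (fun l => quotring_pi I (f l)) s) => l fl.
  by apply: sf => fl0; apply: fl; rewrite fl0 /quotring_pi raddf0.
have [F0 F0E] := choice fex.
have [F FE] : exists F : lhom (reduction I (dsum L (rregular S))) (dsum L (rregular T)),
    forall f, F (red_pi f) = F0 f.
  apply: red_lift => [f g|s f]; apply: dsumP => l.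
    rewrite -[RHS]/(F0 f l + F0 g l) !F0E.
    exact (quotring_piD I (f l) (g l)).
  rewrite -[RHS]/((F0 f l : T) * quotring_pi I s) !F0E.
  exact (quotring_piM I (f l) s).
pose G : lhom (dsum L (rregular T)) (reduction I (dsum L (rregular S))) :=
  dsum_lift (fun l => scale_gen (red_pi (dsum_inj (rregular S) l (1 : S)))).
have GE l (s : S) : G (dsum_inj (rregular T) l (quotring_pi I s)) =
    red_pi (dsum_inj (rregular S) l s).
  rewrite dsum_lift_inj.
  rewrite -[LHS]/((quotring_pi I s : T^c) *: red_pi (dsum_inj (rregular S) l (1 : S))).
  rewrite -red_piZ -lhomZ; congr (red_pi (dsum_inj _ _ _)).
  by rewrite -[LHS]/((1 : S) * s) mul1r.
clearbody G; apply: (@mod_isoI _ _ _ F G).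
  apply: (@red_ext _ _ (lhom_comp G F) (lhom_id _)) => f.
  rewrite -[LHS]/(G (F _)) FE.
  have [s sf] := dsum_supp_seq f.
  have sP l : f l <> 0 -> l \in undup s by move/sf; rewrite mem_undup.
  have sP' l : F0 f l <> 0 -> l \in undup s.
    by rewrite F0E => fl; apply: sP => fl0; apply: fl; rewrite fl0 /quotring_pi raddf0.
  rewrite (@dsum_decomp_seq _ _ _ (F0 f) _ (undup_uniq s) sP') lhom_sum.
  rewrite -[RHS]/(red_pi f) [in RHS](@dsum_decomp_seq _ _ _ f _ (undup_uniq s) sP).
  rewrite red_pi_sum; apply: eq_bigr => l _.
  by rewrite -[dsum_proj _ _ _]/(F0 f l) F0E GE.
apply: (@lhom_eq_id _ _ (lhom_comp F G)); apply: dsum_hom_ext => l x.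
rewrite -[LHS]/(F (G _)) -[RHS]/(dsum_inj _ l x) -(quotring_repr (x : T)) GE FE.
apply: dsumP => k; rewrite F0E /= /dsum_inj_raw; case: eqP => // _.
by rewrite /quotring_pi raddf0.
Qed.

End Reduction.
Arguments PI {S} I P.

Section Projective.
Variable S : pzRingType.
Implicit Types P Q : rmodType S.

Lemma projective_lift P (B C : rmodType S) (q : lhom B C) (th : lhom P C) :
  projective P -> (forall c, exists b, c = q b) ->
  exists F : lhom P B, forall x, th x = q (F x).
Proof.
move=> /in_AddP[L [i [p ip]]] qs.
have [b bE] := choice (fun l : L => qs (th (p (dsum_inj (rregular S) l (1 : S))))).
exists (lhom_comp (dsum_lift (fun l => scale_gen (b l))) i) => x.
rewrite -{1}(ip x) -[RHS]/(lhom_comp q (dsum_lift (fun l => scale_gen (b l))) (i x)).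
apply: (@lhom_eq _ _ _ (lhom_comp th p)); apply: dsum_hom_ext => l s.
rewrite -[LHS]/(th (p _)) -[RHS]/(q (dsum_lift _ _)) dsum_lift_inj.
rewrite -[RHS]/(q ((s : S^c) *: b l)) lhomZ -bE -!lhomZ; congr (th (p (dsum_inj _ _ _))).
by rewrite -[RHS]/((1 : S) * (s : S)) mul1r.
Qed.

(** Homomorphisms between reductions lift, since P is projective and Q maps onto
    its reduction. *)
Lemma red_lifting (I : ideal S) P Q (th : lhom (reduction I P) (reduction I Q)) :
  projective P -> exists F : lhom P Q, forall x, th (red_pi I x) = red_pi I (F x).
Proof.
move=> Pp; pose C := quotmod (mul_ideal I Q).
have lin : linear (fun x : P => th (red_pi I x) : C).
  move=> a x y; rewrite red_piD (red_piZ I a) lhomP_lin; congr (_ + _).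
  exact: (@reduction_scale_pi S I Q a).
have [c|F FE] := @projective_lift P Q C (qpi (mul_ideal I Q)) (mk_lhom lin) Pp.
  by exists (repr c); rewrite qpi_repr.
by exists F => x; exact: FE.
Qed.

End Projective.

(** * Modules generated by the images of a given module *)

Section Covering.
Variable A : pzRingType.
Variables Z B : lmodType A.

(** Elements reached from Z^(nat).  Allowing a countable sum from the start makes
    this a submodule, because Z^(nat) + Z^(nat) is again Z^(nat). *)
Definition covered (b : B) := exists (g : lhom (dsum nat Z) B) z, b = g z.

Lemma covered_span (X : set B) : (forall x, X x -> covered x) ->
  forall b, b \in mspan X -> covered b.
Proof.
move=> XC; apply: mspan_ind => //; first by exists 0, 0.
move=> a _ _ [g [z ->]] [g' [z' ->]].
have /mod_isoE[e [e' [eK e'K]]] := dsum_nat_double Z.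
exists (lhom_comp (lcopair g g') e'), (e (a *: z, z')).
by rewrite -[RHS]/(lcopair g g' (e' _)) eK -lhomZ.
Qed.

Lemma covered_image (f : lhom Z B) z : covered (f z).
Proof.
exists (lhom_comp f (dsum_proj Z 0%N)), (dsum_inj Z 0%N z).
by rewrite -[RHS]/(f (dsum_proj Z _ _)) dsum_proj_inj.
Qed.

Lemma count_gen_cover : count_gen B -> (forall b, covered b) ->
  exists g : lhom (dsum nat Z) B, forall b, exists z, b = g z.
Proof.
move=> [u genu] cov.
have [g gE] := choice (fun n => cov (u n)).
have /mod_isoE[e [e' [eK e'K]]] := dsum_nat_idem Z.
pose G : lhom (dsum nat Z) B := lhom_comp (dsum_lift g) e'.
exists G => b; move: b (genu b); apply: mspan_ind.
- by exists 0; rewrite lhom0.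
- by move=> a _ _ [z ->] [z' ->]; exists (a *: z + z'); rewrite lhomP_lin.
move=> _ [n _ <-]; have [z zE] := gE n.
by exists (e (dsum_inj _ n z)); rewrite -[RHS]/(dsum_lift g (e' _)) eK dsum_lift_inj.
Qed.

End Covering.

Section Trace.
Variables (S : pzRingType) (I : ideal S) (Z : rmodType S).
Hypothesis IZ : forall s : S, s \in I -> (s : rregular S) \in trace Z.

(** An element s of the trace of Z is a sum of values f z with f : Z -> S, and
    p f(-) : Z -> B takes such a value to p f(z). *)
Lemma trace_covered (B : rmodType S) (b : B) : b \in PI I B -> covered Z b.
Proof.
apply: covered_span => _ [s sI [p ->]].
have : scale_gen p (s : rregular S) \in mspan [set x | covered Z x]%classic.
  apply: (span_map _ (IZ sI)) => _ [f [z ->]]; apply: mem_mspan.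
  exact: (covered_image (lhom_comp (scale_gen p) f)).
exact: covered_span.
Qed.

Lemma trace_big_cover (Q : rmodType S) : count_gen Q ->
  (forall q : Q, q \in PI I Q) ->
  exists g : lhom (dsum nat Z) Q, forall q, exists z, q = g z.
Proof. by move=> cQ QI; apply: count_gen_cover cQ _ => q; exact: trace_covered. Qed.

End Trace.

(** * Closure properties of add(U), and trace ideals *)

Section AddClosure.
Variable A : pzRingType.
Implicit Types U V : lmodType A.

Lemma in_add_refl U : in_add U U.
Proof. by apply/in_addP; exists 1%N; exact: retract_dsum1 ord0 U. Qed.

Lemma in_add_retract U V V' : retract V V' -> in_add U V' -> in_add U V.
Proof.
by move=> VV' /in_addP[n V'U]; apply/in_addP; exists n; exact: retract_trans VV' V'U.
Qed.

Lemma in_add_mono U U' V : retract U U' -> in_add U V -> in_add U' V.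
Proof.
move=> UU' /in_addP[n VU]; apply/in_addP; exists n.
exact: retract_trans VU (retract_dsum _ UU').
Qed.

Lemma in_add_dsum n U : in_add U (dsum 'I_n U).
Proof. by apply/in_addP; exists n; exact: retract_refl. Qed.

Lemma retract_dsum_add n m U :
  retract (dsum 'I_n U * dsum 'I_m U)%type (dsum 'I_(n + m) U).
Proof.
pose i : lhom (dsum 'I_n U * dsum 'I_m U)%type (dsum 'I_(n + m) U) :=
  lcopair (dsum_lift (fun k => dsum_inj U (lshift m k)))
          (dsum_lift (fun k => dsum_inj U (rshift n k))).
pose p : lhom (dsum 'I_(n + m) U) (dsum 'I_n U * dsum 'I_m U)%type :=
  dsum_lift (fun k : 'I_(n + m) => match fintype.split k with
    | inl a => lhom_comp (in1 _ _) (dsum_inj U a)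
    | inr b => lhom_comp (in2 _ _) (dsum_inj U b) end).
have iE x y : i (x, y) = dsum_lift (fun k => dsum_inj U (lshift m k)) x +
    dsum_lift (fun k => dsum_inj U (rshift n k)) y by [].
have plE k u : p (dsum_inj U (lshift m k) u) = (dsum_inj U k u, 0).
  by rewrite /p dsum_lift_inj (unsplitK (inl k)).
have prE k u : p (dsum_inj U (rshift n k) u) = (0, dsum_inj U k u).
  by rewrite /p dsum_lift_inj (unsplitK (inr k)).
clearbody i p; exists i, p => -[x y]; rewrite iE lhomD.
have -> : p (dsum_lift (fun k => dsum_inj U (lshift m k)) x) = (x, 0).
  apply: (@lhom_eq _ _ _ (lhom_comp p (dsum_lift _)) (in1 _ _)).
  by apply: dsum_hom_ext => k u; rewrite -[LHS]/(p (dsum_lift _ _)) dsum_lift_inj plE.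
have -> : p (dsum_lift (fun k => dsum_inj U (rshift n k)) y) = (0, y).
  apply: (@lhom_eq _ _ _ (lhom_comp p (dsum_lift _)) (in2 _ _)).
  by apply: dsum_hom_ext => k u; rewrite -[LHS]/(p (dsum_lift _ _)) dsum_lift_inj prE.
by rewrite -[LHS]/(x + 0, 0 + y) addr0 add0r.
Qed.

Lemma in_add_prod U V V' : in_add U V -> in_add U V' -> in_add U (V * V')%type.
Proof.
move=> /in_addP[n VU] /in_addP[m VU']; apply/in_addP; exists (n + m)%N.
exact: retract_trans (retract_prod VU VU') (retract_dsum_add n m U).
Qed.

End AddClosure.

Section TraceIdeal.
Variables (S : pzRingType) (P : rmodType S).

Definition trace_set : {pred S} := trace P.

Fact trace_set_zmod : zmod_closed trace_set.
Proof.
by split=> [|x y xP yP]; [exact: (rpred0 (trace P))|exact: (@rpredB _ (trace P))].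
Qed.
HB.instance Definition _ := GRing.isZmodClosed.Build S trace_set trace_set_zmod.

Fact trace_set_mull a : {in trace_set, forall x, a * x \in trace_set}.
Proof.
have lin : linear ((fun x => a * (x : S)) : rregular S -> rregular S).
  by move=> b x y; rewrite mulrDr; congr (_ + _); exact (@mulrA S a x b).
pose la : lhom (rregular S) (rregular S) := mk_lhom lin.
move=> x xP; rewrite -[a * x]/(la x); apply: span_map xP => _ [f [p ->]].
by apply: mem_mspan; exists (lhom_comp la f), p.
Qed.

Fact trace_set_mulr a : {in trace_set, forall x, x * a \in trace_set}.
Proof.
move=> x; rewrite -[x \in _]/((x : rregular S) \in mspan _) => xP.
exact (rpredZ (a : S^c) xP).
Qed.

HB.instance Definition _ := isTwoSided.Build S trace_set trace_set_mull trace_set_mulr.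

Definition ideal_of_trace : ideal S := trace_set.

Lemma ideal_of_traceE s : (s \in ideal_of_trace) = (s \in trace P).
Proof. by []. Qed.

End TraceIdeal.

(** * The image of alpha for a single ideal *)

Section OneIdeal.
Variables (R : pzRingType) (M : rmodType R).
Hypothesis M_fg : fin_gen M.
Notation S := (Endo M).
Notation H N := (lhom M N : rmodType S).
Implicit Types N Y : rmodType R.
Variables (I : ideal S) (X : rmodType R).
Hypothesis XM : retract X (dsum nat M).
Hypothesis IX : forall s : S, (s \in I) = (s \in trace (lhom M X)).
Notation W := (dsum nat X).
Notation T := (quotring I).
Notation red N := (reduction I (H N)).

(** A projective module P satisfies P = P tr(P), here for P = Hom(M, N): the
    coefficients in the dual basis expansion lie in the trace. *)
Lemma trace_hom_PI (L : choiceType) N (J : ideal S) : retract N (dsum L M) ->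
  (forall s : S, s \in trace (lhom M N) -> s \in J) -> forall h : H N, h \in PI J (H N).
Proof.
move=> [i [p ip]] JN h; have [s [-> _]] := hom_decomp M_fg h ip.
apply: rpred_sum => l _; apply: (PI_mul (lhom_comp p (dsum_inj M l) : H N)); apply: JN.
have lin : linear (fun s : lhom M M => (s : rregular S)) by [].
pose reg : lhom (H M) (rregular S) := @mk_lhom _ (H M) (rregular S) _ lin.
apply: mem_mspan.
by exists (lhom_comp reg (lhom_post M (lhom_comp (dsum_proj M l) i))), h; apply: lhomP.
Qed.

Lemma hom_dsum_PI (L : choiceType) V : (forall h : H V, h \in PI I (H V)) ->
  forall h : H (dsum L V), h \in PI I (H (dsum L V)).
Proof.
move=> VI h; have [s hs] := fin_gen_decomp h M_fg.
have -> : h = \sum_(l <- s) lhom_comp (dsum_inj V l) (lhom_comp (dsum_proj V l) h).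
  by apply: lhomP => m; rewrite lhom_sumE hs.
by apply: rpred_sum => l _; apply: (PI_map (lhom_post M (dsum_inj V l))).
Qed.

Lemma hom_W_PI (h : H W) : h \in PI I (H W).
Proof. by apply: hom_dsum_PI; apply: trace_hom_PI XM _ => t; rewrite IX. Qed.

Lemma dsum_nat_retract V : retract V (dsum nat M) -> retract (dsum nat V) (dsum nat M).
Proof.
move=> VM; apply: retract_trans (retract_dsum nat VM) _.
exact/iso_retract/dsum_nat_idem.
Qed.

(** A map f whose image under Hom(M, -) lands in Hom(M, N') I factors through
    W = X^(w).  On each summand M of M^(w), the map f is an element of
    Hom(M, N') I, hence is reached from Hom(M, X)^(w) = Hom(M, W); full
    faithfulness turns this into a factorization through W, and the countably many
    copies of W so obtained make up one W. *)
Lemma PI_thru N N' (f : lhom N N') : retract N (dsum nat M) ->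
  (forall h : lhom M N, (lhom_comp f h : H N') \in PI I (H N')) -> factors_thru W f.
Proof.
move=> [i [p ip]] fI.
have thruM n : factors_thru W (lhom_comp f (lhom_comp p (dsum_inj M n))).
  have IXl s : s \in I -> (s : rregular S) \in trace (lhom M X) by rewrite IX.
  have [g [z ->]] := trace_covered IXl (fI (lhom_comp p (dsum_inj M n))).
  have /mod_isoE[u [v [uK vK]]] := hom_dsum M_fg nat X.
  have [b bE] := hom_full M_fg (lhom_comp g u) (dsum_nat_retract XM).
  by exists (v z), b => m; rewrite -[RHS]/(lhom_comp b (v z) m) -bE /= vK.
have [a aE] := choice thruM; have [b bE] := choice aE.
have /mod_isoE[e [e' [eK e'K]]] := dsum_nat_idem X.
exists (lhom_comp e (lhom_comp (dsum_map a) i)), (lhom_comp (dsum_lift b) e') => x.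
rewrite -[RHS]/(dsum_lift b (e' (e (dsum_map a (i x))))) eK -{1}(ip x).
apply: (@lhom_eq _ _ _ (lhom_comp f p) (lhom_comp (dsum_lift b) (dsum_map a))).
apply: dsum_hom_ext => n m.
rewrite -[LHS]/(lhom_comp f (lhom_comp p (dsum_inj M n)) m) bE.
by rewrite -[RHS]/(dsum_lift b (dsum_map a _)) dsum_map_inj dsum_lift_inj.
Qed.

(** The identity of N factors through W, because Hom(M, N) = Hom(M, N) I. *)
Lemma trace_sub_retract N : retract N (dsum nat M) ->
  (forall s : S, s \in trace (lhom M N) -> s \in I) -> retract N W.
Proof.
move=> NM NI; have [|a [b ab]] := @PI_thru N N (lhom_id N) NM.
  by move=> h; apply: (trace_hom_PI NM NI).
by exists a, b => x; rewrite -ab.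
Qed.

Lemma hom_red_lifting N N' (th : lhom (red N) (red N')) : retract N (dsum nat M) ->
  exists f : lhom N N', forall h : lhom M N,
    th (red_pi I (h : H N)) = red_pi I (lhom_comp f h : H N').
Proof.
move=> NM; have [F FE] := red_lifting th (hom_projective M_fg NM).
have [f fE] := hom_full M_fg F NM; exists f => h.
by rewrite FE fE.
Qed.

Lemma red_id_thru N (f : lhom N N) : retract N (dsum nat M) ->
  (forall h : lhom M N, red_pi I (lhom_comp f h : H N) = red_pi I (h : H N)) ->
  factors_thru W (lhom_id N - f).
Proof.
move=> NM fh; apply: PI_thru NM _ => h.
have -> : lhom_comp (lhom_id N - f) h = (h : H N) - lhom_comp f h by apply: lhomP.
exact/red_piP/esym/fh.
Qed.

Lemma red_iso_absorb N N' : retract N (dsum nat M) -> retract N' (dsum nat M) ->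
  mod_iso (red N) (red N') -> mod_iso (N * W)%type (N' * W)%type.
Proof.
move=> NM NM' /mod_isoE[th [th' [thK th'K]]].
have [f fE] := hom_red_lifting th NM; have [g gE] := hom_red_lifting th' NM'.
apply: (@iso_absorb _ X _ _ f g); apply: red_id_thru => // h.
  by rewrite lhom_compA -gE -fE thK.
by rewrite lhom_compA -fE -gE th'K.
Qed.

(** As in [red_iso_absorb], with only one of the two composites known to be the
    identity modulo I. *)
Lemma red_retract_absorb N N' : retract N (dsum nat M) -> retract N' (dsum nat M) ->
  retract (red N) (red N') -> retract N (N' * W)%type.
Proof.
move=> NM NM' [th [th' thK]].
have [f fE] := hom_red_lifting th NM; have [g gE] := hom_red_lifting th' NM'.
have [|a [b abE]] := @red_id_thru N (lhom_comp g f) NM.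
  by move=> h; rewrite lhom_compA -gE -fE thK.
exists (lpair f a), (lcopair g b) => x.
by rewrite -[LHS]/(g (f x) + b (a x)) -abE addrC subrK.
Qed.

Lemma red_hom_free n :
  mod_iso (red (dsum 'I_n M)) (dsum 'I_n (rregular T)).
Proof.
apply: mod_iso_trans (red_free I 'I_n); apply: mod_iso_red.
apply: mod_iso_trans (hom_dsum M_fg 'I_n M) _.
have /mod_isoE[f [g [fK gK]]] := hom_regular M.
apply: (@mod_isoI _ _ _ (dsum_map (fun=> f)) (dsum_map (fun=> g))).
  apply: (@lhom_eq_id _ _ (lhom_comp (dsum_map (fun=> g)) (dsum_map (fun=> f)))).
  by apply: dsum_hom_ext => k x; rewrite -[LHS]/(dsum_map _ (dsum_map _ _)) !dsum_map_inj fK.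
apply: (@lhom_eq_id _ _ (lhom_comp (dsum_map (fun=> f)) (dsum_map (fun=> g)))).
by apply: dsum_hom_ext => k x; rewrite -[LHS]/(dsum_map _ (dsum_map _ _)) !dsum_map_inj gK.
Qed.

(** A countably generated Q with QI = Q is already an image of Hom(M, X)^(w) = Hom(M, W). *)
Lemma big_hom_prod N : is_big I (H (N * W)%type).
Proof.
move=> Q cQ pQ QI.
have IXl s : s \in I -> (s : rregular S) \in trace (lhom M X) by rewrite IX.
have [g gs] := trace_big_cover IXl cQ QI.
have /mod_isoE[u [v [uK vK]]] := hom_dsum M_fg nat X.
exists (lhom_comp g (lhom_comp u (lhom_post M (pr2 N W)))) => q.
have [z ->] := gs q; exists (lhom_comp (in2 N W) (v z)).
rewrite -[RHS]/(g (u (lhom_comp (pr2 N W) (lhom_comp (in2 N W) (v z))))).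
have -> : lhom_comp (pr2 N W) (lhom_comp (in2 N W) (v z)) = v z by apply: lhomP.
by rewrite vK.
Qed.

Lemma is_big_iso (J : ideal S) (P P' : rmodType S) :
  mod_iso P P' -> is_big J P -> is_big J P'.
Proof.
move=> /mod_isoE[f [g [fK _]]] bP Q cQ pQ QJ.
have [q qs] := bP Q cQ pQ QJ; exists (lhom_comp q g) => x.
by have [y ->] := qs x; exists (f y); rewrite -[RHS]/(q (g (f y))) fK.
Qed.

(** An I-big module maps onto Hom(M, W), and this surjection splits. *)
Lemma big_hom_retract N : retract N (dsum nat M) -> is_big I (H N) -> retract W N.
Proof.
move=> NM bN; have WM := dsum_nat_retract XM.
have [q qs] := bN (H W) (hom_count_gen M_fg WM) (hom_projective M_fg WM) hom_W_PI.
have [s sE] := projective_lift (lhom_id (H W)) (hom_projective M_fg WM) qs.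
have [q' q'E] := hom_full M_fg q NM; have [s' s'E] := hom_full M_fg s WM.
exists s', q'; apply: (@lhom_eq_id _ _ (lhom_comp q' s')).
apply: (hom_faithful WM) => h.
by rewrite lhom_compA -s'E -q'E -sE; apply: lhomP.
Qed.

Lemma red_hom_prod N : mod_iso (red (N * W)%type) (red N).
Proof.
apply: (@red_iso _ _ (H (N * W)%type) (H N)
  (lhom_post M (pr1 N W)) (lhom_post M (in1 N W))) => h.
  have -> : (h : H (N * W)%type) - lhom_post M (in1 N W) (lhom_post M (pr1 N W) h) =
      lhom_post M (in2 N W) (lhom_comp (pr2 N W) h).
    apply: lhomP => m; rewrite -[RHS]/(0, (h m).2).
    rewrite -[LHS]/((h m).1 - (h m).1, (h m).2 - 0).
    by rewrite subrr subr0.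
  by apply: PI_map; exact: hom_W_PI.
have -> : lhom_post M (pr1 N W) (lhom_post M (in1 N W) h) = h by apply: lhomP.
by rewrite subrr rpred0.
Qed.

(** Reduction kills W, so that (M + W)^n reduces to (S/I)^n. *)
Lemma red_in_add Y : in_add (M * W)%type Y -> in_add (rregular T) (red Y).
Proof.
move=> /in_addP[n [i [p ip]]]; apply/in_addP; exists n.
apply: retract_trans _ (iso_retract (red_hom_free n)).
pose d1 : lhom (dsum 'I_n (M * W)%type) (dsum 'I_n M) := dsum_map (fun=> pr1 M W).
pose d2 : lhom (dsum 'I_n (M * W)%type) (dsum 'I_n W) := dsum_map (fun=> pr2 M W).
pose c1 : lhom (dsum 'I_n M) (dsum 'I_n (M * W)%type) := dsum_map (fun=> in1 M W).
pose c2 : lhom (dsum 'I_n W) (dsum 'I_n (M * W)%type) := dsum_map (fun=> in2 M W).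
(* The identity of (M + W)^n is the sum of the projections to M^n and W^n, the
   second of which vanishes modulo I. *)
have cd x : x = c1 (d1 x) + c2 (d2 x).
  apply: (@lhom_eq _ _ _ (lhom_id _) (lhom_comp c1 d1 + lhom_comp c2 d2)).
  apply: dsum_hom_ext => k [m w].
  rewrite -[RHS]/(c1 (d1 (dsum_inj _ k (m, w))) + c2 (d2 (dsum_inj _ k (m, w)))).
  rewrite /c1 /c2 /d1 /d2 !dsum_map_inj -lhomD -[LHS]/(dsum_inj _ k (m, w)).
  by congr (dsum_inj _ _ _); rewrite -[RHS]/(m + 0, 0 + w) addr0 add0r.
clearbody d1 d2 c1 c2.
apply: (@red_retract _ _ (H Y) (H (dsum 'I_n M)) (lhom_post M (lhom_comp d1 i))
  (lhom_post M (lhom_comp p c1))) => h.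
have -> : (h : H Y) - lhom_post M (lhom_comp p c1) (lhom_post M (lhom_comp d1 i) h) =
    lhom_post M (lhom_comp p c2) (lhom_comp d2 (lhom_comp i h)).
  apply: lhomP => m; rewrite -[RHS]/(p (c2 (d2 (i (h m))))).
  rewrite -[LHS]/(h m - p (c1 (d1 (i (h m))))) -{1}(ip (h m)) -lhomB.
  by congr (p _); rewrite {1}(cd (i (h m))) addrC addKr.
by apply: PI_map; apply: hom_dsum_PI; exact: hom_W_PI.
Qed.

(** N is P (x) M for the I-big projective module P that defines alpha. *)
Lemma alpha_mem (Q : rmodType T) N' : alpha (iso_class Q) N' -> exists N,
  [/\ retract N (dsum nat M), retract W N, mod_iso (red N) Q & mod_iso N N'].
Proof.
move=> [P [Q' QQ' [cP pP bP rP]] PN'].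
have cS := fin_count_gen (fin_gen_regular S).
have PS : retract P (dsum nat (rregular S)) by apply/(in_AddcP _ cS).
have [NM PH] := retract_regular_tensor M_fg PS.
exists (tensor_M P); split=> //.
  exact: big_hom_retract NM (is_big_iso PH bP).
apply: mod_iso_trans (mod_iso_red I (mod_iso_sym PH)) _.
exact: mod_iso_trans rP (mod_iso_sym QQ').
Qed.

(** The computation of alpha: its value on the reduction of N is N + W.  A module
    in the class alpha(Q) absorbs W and has the same reduction as N, so it is
    N + W; and Hom(M, N + W) is an I-big projective module with reduction Q. *)
Lemma alpha_eq (Q : rmodType T) N : retract N (dsum nat M) -> mod_iso (red N) Q ->
  alpha (iso_class Q) = iso_class (N * W)%type.
Proof.
move=> NM NQ; apply/funext => N'; apply/propext; split=> [/alpha_mem|NN'].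
  move=> [N0 [N0M WN0 N0Q N0N']].
  apply: mod_iso_trans (mod_iso_trans (retract_absorbed WN0) N0N').
  exact: red_iso_absorb NM N0M (mod_iso_trans NQ (mod_iso_sym N0Q)).
have NWM : retract (N * W)%type (dsum nat M).
  apply: retract_trans (retract_prod NM (dsum_nat_retract XM)) _.
  exact/iso_retract/dsum_nat_double.
exists (H (N * W)%type); last exact: mod_iso_trans (tensor_hom_iso M_fg NWM) NN'.
exists (red (N * W)%type).
  exact: mod_iso_sym (mod_iso_trans (red_hom_prod N) NQ).
split; [exact: hom_count_gen|exact: hom_projective NWM|exact: big_hom_prod|].
exact: mod_iso_refl.
Qed.

(** If the reduction of N is a retract of (S/I)^n, which is the reduction of M^n,
    then N is a retract of M^n + W. *)
Lemma in_add_absorb N (Q : rmodType T) : retract N (dsum nat M) -> mod_iso (red N) Q ->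
  in_add (rregular T) Q -> in_add (M * W)%type N.
Proof.
move=> NM NQ /in_addP[n QT].
have NMW : retract N (dsum 'I_n M * W)%type.
  apply: red_retract_absorb NM (retract_ord_nat n M) _.
  apply: retract_trans (iso_retract NQ) (retract_trans QT _).
  exact/iso_retract/mod_iso_sym/red_hom_free.
apply: in_add_retract NMW (in_add_prod _ _).
  exact: in_add_mono (retract_l M W) (in_add_dsum n M).
exact: in_add_retract (retract_r M W) (in_add_refl _).
Qed.

Lemma alpha_imageP Y : in_Addc M Y -> alpha_image I (iso_class Y) <->
  mod_iso Y (Y * W)%type /\ in_add (M * W)%type Y.
Proof.
move=> /(in_AddcP _ (fin_count_gen M_fg)) YM; split=> [[D [Q QT ->] YQ]|[YW YMW]].
  have [N [NM WN NQ NY]] : exists N,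
      [/\ retract N (dsum nat M), retract W N, mod_iso (red N) Q & mod_iso N Y].
    by apply: alpha_mem; rewrite -YQ; exact: mod_iso_refl.
  split; first exact/mod_iso_sym/retract_absorbed/(retract_trans WN)/iso_retract.
  exact: in_add_retract (iso_retract (mod_iso_sym NY)) (in_add_absorb NM NQ QT).
exists (iso_class (red Y)); first by exists (red Y); [exact: red_in_add|].
rewrite (alpha_eq YM (mod_iso_refl _)); exact/iso_classP.
Qed.

End OneIdeal.

(** * Comparison of the ideals *)

Section Vanishing.
Variables (A : pzRingType).
Implicit Types M N V X : lmodType A.

Definition trivial V := forall x : V, x = 0.

Lemma trivial_dsum (L : choiceType) V : trivial V -> trivial (dsum L V).
Proof. by move=> V0 f; apply: dsumP => l; rewrite (V0 (f l)). Qed.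

Lemma trivial_prod_retract M V : trivial V -> retract (M * V)%type M.
Proof.
by move=> V0; exists (pr1 M V), (in1 M V) => -[m v] /=; congr (_, _); rewrite (V0 v).
Qed.

Lemma retract_fin_gen_trivial X N : fin_gen N -> retract (dsum nat X) N -> trivial X.
Proof.
move=> N_fg [i [p ip]]; have [s _ ps] := fin_gen_supp p N_fg => x.
(* k is an index outside the finite set of summands met by N. *)
pose k := (\max_(l <- s) l).+1.
have ks : k \notin s.
  apply/negP => ks.
  by have := @leq_bigmax_seq _ s predT (fun l : nat => l) k ks isT; rewrite ltnn.
apply: contrapT => x0; move/negP: ks; apply; apply: (ps (i (dsum_inj X k x))).
by rewrite ip -[X in X <> 0]/(dsum_proj X k _) dsum_proj_inj.
Qed.

End Vanishing.

Section Main.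
Variables (R : pzRingType) (M : rmodType R).
Hypothesis M_fg : fin_gen M.
Notation S := (Endo M).
Notation H N := (lhom M N : rmodType S).

Lemma retract_in_Addc N : retract N (dsum nat M) -> in_Addc M N.
Proof. by move/(in_AddcP _ (fin_count_gen M_fg)). Qed.

Lemma in_Addc_retract N : in_Addc M N -> retract N (dsum nat M).
Proof. by move/(in_AddcP _ (fin_count_gen M_fg)). Qed.

Lemma in_add_Addc N : in_add M N -> in_Addc M N.
Proof.
move=> /in_addP[n NM]; apply: retract_in_Addc.
exact: retract_trans NM (retract_ord_nat n M).
Qed.

Lemma in_add_fin_gen N : in_add M N -> fin_gen N.
Proof. by move=> /in_addP[n NM]; apply: retract_fin_gen NM (fin_gen_dsum _ M_fg). Qed.

Lemma trace_ideal_hom N : retract N (dsum nat M) ->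
  trace_ideal (ideal_of_trace (H N)).
Proof.
move=> NM; exists (H N).
by split; [exact: hom_count_gen|exact: hom_projective NM|exact: ideal_of_traceE].
Qed.

Lemma hom_trivial N : retract N (dsum nat M) -> (forall h : lhom M N, h = 0) ->
  trivial N.
Proof.
move=> NM h0 x; apply: (@lhom_eq _ _ _ (lhom_id N) 0).
by apply: (hom_faithful NM) => h; rewrite (h0 h); apply: lhomP.
Qed.

Lemma trace_trivial N : trivial N -> forall s, s \in trace (H N) -> s = 0.
Proof.
move=> N0; apply: mspan_ind => [//|a u v -> ->|_ [f [h ->]]].
  by rewrite scaler0 addr0.
by rewrite (_ : h = 0) ?lhom0 //; apply: lhomP => m; exact: N0.
Qed.

Variable X : ideal S -> rmodType R.
Hypothesis XM : forall I, trace_ideal I -> retract (X I) (dsum nat M).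
Hypothesis X_trace : forall I, trace_ideal I ->
  forall s : S, (s \in I) = (s \in trace (H (X I))).
Notation W I := (dsum nat (X I)).

(** Hom(M, X_I) = Hom(M, X_I) I, so X_I vanishes together with I. *)
Lemma X_trivial I : trace_ideal I -> (forall s, s \in I -> s = 0) -> trivial (X I).
Proof.
move=> tI I0; apply: (hom_trivial (XM tI)) => h.
have : h \in PI I (H (X I)).
  by apply: (trace_hom_PI M_fg (XM tI)) => s; rewrite -X_trace.
move: h; apply: mspan_ind => [//|a u v -> ->|_ [s /I0-> [p ->]]].
  by rewrite scaler0 addr0.
by apply: lhomP => m; rewrite /= linear0.
Qed.

Lemma in_Addc_W I : trace_ideal I -> retract (W I) (dsum nat M).
Proof. by move/XM; exact: dsum_nat_retract. Qed.

Lemma trace_hom_mono N N' : retract N N' ->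
  forall s : S, s \in trace (H N) -> s \in trace (H N').
Proof.
move=> /(retract_hom M)[i [p ip]]; apply: mspan_sub => _ [f [h ->]].
by apply: mem_mspan; exists (lhom_comp f p), (i h); rewrite /= ip.
Qed.

(** The ideal K is I + J.  Both X_I and X_J are summands of X_K^(w), which puts
    Y + Z in add(M + X_K^(w)); and X_K is a summand of (X_I + X_J)^(w), which
    Y + Z absorbs. *)
Lemma alpha_image_prod I J Y Z : trace_ideal I -> trace_ideal J ->
  retract Y (dsum nat M) -> retract Z (dsum nat M) ->
  alpha_image I (iso_class Y) -> alpha_image J (iso_class Z) ->
  let K := ideal_of_trace (H (X I * X J)%type) in
  alpha_image K (iso_class (Y * Z)%type).
Proof.
move=> tI tJ YM ZM.
have imP := fun K tK => @alpha_imageP R M M_fg K (X K) (XM tK) (X_trace tK).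
move=> /(imP _ tI _ (retract_in_Addc YM))[YW Yadd].
move=> /(imP _ tJ _ (retract_in_Addc ZM))[ZW Zadd] K.
have XXM : retract (X I * X J)%type (dsum nat M).
  apply: retract_trans (retract_prod (XM tI) (XM tJ)) _.
  exact/iso_retract/dsum_nat_double.
have tK : trace_ideal K by exact: trace_ideal_hom.
have XIK : retract (X I) (W K).
  apply: (trace_sub_retract M_fg (XM tK) (X_trace tK) (XM tI)) => s.
  rewrite ideal_of_traceE.
  exact: trace_hom_mono (retract_l _ _) _.
have XJK : retract (X J) (W K).
  apply: (trace_sub_retract M_fg (XM tK) (X_trace tK) (XM tJ)) => s.
  rewrite ideal_of_traceE.
  exact: trace_hom_mono (retract_r _ _) _.
have WK V : retract V (W K) -> retract (dsum nat V) (W K).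
  move=> VW; apply: retract_trans (retract_dsum nat VW) _.
  exact/iso_retract/dsum_nat_idem.
have YZM : in_Addc M (Y * Z)%type.
  apply: retract_in_Addc; apply: retract_trans (retract_prod YM ZM) _.
  exact/iso_retract/dsum_nat_double.
apply/(imP _ tK _ YZM); split; last first.
  apply: in_add_prod.
    exact: in_add_mono (retract_prod (retract_refl M) (WK _ XIK)) Yadd.
  exact: in_add_mono (retract_prod (retract_refl M) (WK _ XJK)) Zadd.
apply/mod_iso_sym/retract_absorbed.
have XKW : retract (X K) (dsum nat (X I * X J)%type).
  apply: (trace_sub_retract M_fg XXM (@ideal_of_traceE _ _) (XM tK)) => s.
  by rewrite -X_trace.
apply: (retract_trans (V := dsum nat (X I * X J)%type)).
  apply: retract_trans (retract_dsum nat XKW) _.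
  exact/iso_retract/dsum_nat_idem.
apply: retract_trans (iso_retract (dsum_prod _ _ _)) (retract_prod _ _).
  exact: retract_trans (retract_r _ _) (iso_retract (mod_iso_sym YW)).
exact: retract_trans (retract_r _ _) (iso_retract (mod_iso_sym ZW)).
Qed.

End Main.

Theorem theorem3p8 (R : pzRingType) (M : rmodType R) (M_fg : fin_gen M)
    (X : ideal (Endo M) -> rmodType R)
    (X_Add : forall I, trace_ideal I -> in_Addc M (X I))
    (X_trace : forall I, trace_ideal I ->
       forall s : Endo M, (s \in I) = (s \in trace (lhom M (X I))))
    (G : forall I : ideal (Endo M), functorJ (quotring I) (X I))
    (G_inverse : forall I, trace_ideal I -> inverse_equivalence (G I))
    (G_count_gen : forall I, trace_ideal I -> preserves_count_gen (G I)) :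
  [/\ (* (i) *)
      forall I : ideal (Endo M), trace_ideal I -> (exists2 s, s \in I & s != 0) ->
      forall Q : rmodType (quotring I), in_add (rregular (quotring I)) Q ->
        alpha (iso_class Q) = iso_class (G I Q * dsum nat (X I))%type,
      (* (ii) *)
      forall (Y : rmodType R) (I : ideal (Endo M)), in_Addc M Y -> trace_ideal I ->
        alpha_image I (iso_class Y) <->
        mod_iso Y (Y * dsum nat (X I))%type /\ in_add (M * dsum nat (X I))%type Y,
      (* (iii) *)
      is_subsemigroup (fun C => V_count M C /\ ~ V_fin M C) (B_set M)
    & (* (iv) *)
      [/\ forall C, ~ (V_fin M C /\ B_set M C),
          forall C, V_fin M C \/ B_set M C <->
            exists2 I : ideal (Endo M), trace_ideal I & alpha_image I C
        & is_submonoid (V_count M) (fun C => V_fin M C \/ B_set M C)] ].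
Proof.
have XM I (tI : trace_ideal I) : retract (X I) (dsum nat M).
  exact: in_Addc_retract (X_Add _ tI).
have imP I Y (tI : trace_ideal I) (YM : in_Addc M Y) :=
  alpha_imageP M_fg (XM I tI) (X_trace I tI) YM.
(* By the counit of the equivalence, G_I(Q) is a countably generated object of
   Add(M) with reduction Q; so the computation of alpha applies to it. *)
have alphaG I (tI : trace_ideal I) (Q : rmodType (quotring I)) :
    in_add (rregular (quotring I)) Q ->
    retract (G I Q) (dsum nat M) /\
    alpha (iso_class Q) = iso_class (G I Q * dsum nat (X I))%type.
  move=> /in_addP[n QT].
  have Qfg : fin_gen Q.
    exact: retract_fin_gen QT (fin_gen_dsum _ (fin_gen_regular _)).
  have Qp : projective Q by apply/in_AddP; exists 'I_n.
  have [[GM _ _] [eta [_ [eta_bij _ _ _]]]] := G_inverse I tI.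
  have GQM : retract (G I Q) (dsum nat M).
    apply: (in_Addc_retract M_fg); split; last exact: GM.
    exact: G_count_gen tI Q Qp (fin_count_gen Qfg).
  split=> //; apply: (alpha_eq M_fg (XM I tI) (X_trace I tI) GQM).
  apply: mod_iso_trans (mod_iso_sym (tensor_red I _)) _.
  by exists (eta Q); exact: eta_bij.
have rep (I : ideal (Endo M)) C : trace_ideal I -> alpha_image I C ->
    exists2 Y, retract Y (dsum nat M) & C = iso_class Y.
  move=> tI [D [Q QT ->] ->]; have [GQM ->] := alphaG I tI Q QT.
  exists (G I Q * dsum nat (X I))%type => //.
  apply: retract_trans (retract_prod GQM (in_Addc_W XM tI)) _.
  exact/iso_retract/dsum_nat_double.
have nonfin (I : ideal (Endo M)) C : trace_ideal I -> (exists2 s, s \in I & s != 0) ->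
    alpha_image I C -> ~ V_fin M C.
  move=> tI [s sI /eqP s0] IC [N NM CN].
  have [YW _] : mod_iso N (N * dsum nat (X I))%type /\ in_add (M * dsum nat (X I))%type N.
    by apply/(imP _ _ tI (in_add_Addc M_fg NM)); rewrite -CN.
  have X0 : trivial (X I).
    apply: (retract_fin_gen_trivial (in_add_fin_gen M_fg NM)).
    exact: retract_trans (retract_r N _) (iso_retract (mod_iso_sym YW)).
  by apply: s0; apply: (trace_trivial X0); rewrite -X_trace.
have union C : V_fin M C \/ B_set M C <->
    exists2 I : ideal (Endo M), trace_ideal I & alpha_image I C.
  split=> [[[N NM ->]|[I [tI _ IC]]]|[I tI IC]]; last 2 first.
  - by exists I.
  - have [I0|I0] := pselect (exists2 s, s \in I & s != 0); first by right; exists I.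
    have X0 : trivial (X I).
      apply: (X_trivial M_fg XM X_trace tI) => s sI; apply/eqP/negPn/negP => s0.
      by apply: I0; exists s.
    have [Y YM CY] := rep I C tI IC; left; exists Y => //.
    have [_] : mod_iso Y (Y * dsum nat (X I))%type /\ in_add (M * dsum nat (X I))%type Y.
      by apply/(imP _ _ tI (retract_in_Addc M_fg YM)); rewrite -CY.
    by apply: in_add_mono; apply: trivial_prod_retract; apply: trivial_dsum.
  (* V(M) is the image of alpha for the zero ideal, the trace of the zero module. *)
  pose O : rmodType R := dsum 'I_0 M.
  have O0 : trivial O by move=> x; apply: dsumP => -[].
  have OM : retract O (dsum nat M) := retract_ord_nat 0 M.
  pose I := ideal_of_trace (lhom M O : rmodType (Endo M)).
  have tI : trace_ideal I := trace_ideal_hom M_fg OM.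
  have X0 : trivial (X I).
    apply: (X_trivial M_fg XM X_trace tI) => s; rewrite ideal_of_traceE.
    exact: trace_trivial O0 s.
  exists I => //; apply/(imP _ _ tI (in_add_Addc M_fg NM)); split.
    apply/mod_iso_sym/retract_absorbed; exists 0, 0 => x.
    by rewrite [RHS](trivial_dsum X0).
  exact: in_add_mono (retract_l _ _) NM.
have count C : V_fin M C \/ B_set M C -> V_count M C.
  move=> /union[I tI /(rep I C tI)[Y YM ->]]; exists Y => //.
  exact: retract_in_Addc.
have closed (I J : ideal (Endo M)) C D : trace_ideal I -> trace_ideal J -> alpha_image I C ->
    alpha_image J D -> exists K : ideal (Endo M), [/\ trace_ideal K, {subset I <= K} &
      alpha_image K (class_add C D)].
  move=> tI tJ IC JD; have [Y YM CY] := rep I C tI IC; have [Z ZM DZ] := rep J D tJ JD.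
  rewrite CY in IC *; rewrite DZ in JD *; rewrite class_add_iso.
  exists (ideal_of_trace (lhom M (X I * X J)%type : rmodType (Endo M))); split.
  - apply: (trace_ideal_hom M_fg).
    apply: retract_trans (retract_prod (XM I tI) (XM J tJ)) _.
    exact/iso_retract/dsum_nat_double.
  - move=> s; rewrite ideal_of_traceE X_trace //.
    exact: trace_hom_mono (retract_l _ _) s.
  exact: (alpha_image_prod M_fg XM X_trace tI tJ YM ZM IC JD).
split.
- by move=> I tI _ Q /(alphaG I tI)[].
- by move=> Y I YM tI; exact: imP.
- split=> [C BC|C D [I [tI [s sI s0] IC]] [J [tJ _ JD]]].
    split; first by apply: count; right.
    by case: BC => I [tI I0 IC]; exact: nonfin tI I0 IC.
  have [K [tK IK KCD]] := closed I J C D tI tJ IC JD.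
  by exists K; split=> //; exists s => //; exact: IK.
split=> //.
- by move=> C [VC [I [tI I0 IC]]]; exact: (nonfin I C tI I0 IC).
split; first split=> [C|C D]; first exact: count.
- move=> /union[I tI IC] /union[J tJ JD]; apply/union.
  by have [K [tK _ KCD]] := closed I J C D tI tJ IC JD; exists K.
left; exists (dsum 'I_0 M); first exact: in_add_dsum.
have O0 : trivial (dsum 'I_0 M) by move=> x; apply: dsumP => -[].
apply/funext => N; apply/propext; split=> [N0|/mod_isoE[f [g [_ gK]]] x].
  by apply: (@mod_isoI _ _ _ 0 0) => x; rewrite [RHS]O0 + rewrite [RHS]N0.
by rewrite -(gK x) (O0 (g x)) lhom0.
Qed.
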